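(* Let $0<q<1$. Suppose that $\lambda(N)$, a sequence of signatures with $\lambda(N)$ of size $N$, is such that $\lambda_{N-j+1}(N)\to\nu_j$ as $N\to\infty$ for every $j$. Then $$\frac{s_{\lambda(N)}(x_1,\dots,x_k,q^{-k},q^{-k-1},\dots,q^{1-N})}{s_{\lambda(N)}(1,q^{-1},\dots,q^{1-N})}\to F^{(k)}_\nu(x_1,\dots,x_k),$$ where $$F^{(k)}_\nu(x_1,\dots,x_k)=\frac{(-1)^{\binom k2}\,q^{-2\binom k3}}{\Delta(x_1,\dots,x_k)\prod_{i}(x_iq^{k-1};q)_\infty}\;\det\bigl[D_{i,q^{-1}}^{\,j-1}\bigr]_{i,j=1}^k\prod_{i=1}^kF_\nu(x_iq^{k-1})\,(x_iq^{k-1};q)_\infty.$$ The convergence is uniform over each $x_i$ belonging to compact subsets of $\mathbb C\setminus\{0\}$.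
   Context: A signature of size $N$ is an $N$-tuple of integers $\lambda_1\ge\cdots\ge\lambda_N$; $s_\lambda(u_1,\dots,u_N)=\det[u_i^{\lambda_j+N-j}]_{i,j=1}^N/\prod_{i<j}(u_i-u_j)$ is the Schur function. Here $\nu_1\le\nu_2\le\cdots$ are integers, $\Delta(x_1,\dots,x_k)=\prod_{i<j}(x_i-x_j)$, $(a;q)_\infty=\prod_{i\ge0}(1-aq^i)$. For a parameter $p$, $D_{i,p}$ is the difference operator acting on the variable $x_i$ by $$[D_{i,p}f](x_i)=\frac{f(px_i)-f(x_i)}{p-1},$$ used here with $p=q^{-1}$; these operators commute, and the determinant operator acts on the product over $i$ to its right. The function $F_\nu$ is $$F_\nu(x)=\prod_{j=0}^\infty\frac{1-q^{j+1}}{1-q^{j+1}x}\cdot\frac{\ln(q)}{2\pi\mathbf{i}}\int_{\mathcal C'}\frac{x^z}{\prod_{j=1}^\infty(1-q^{-z}q^{\nu_j+j-1})}\,dz,\qquad \mathbf{i}=\sqrt{-1},$$ where $\mathcal C'$ consists of two infinite half-lines $\mathrm{Im}(z)=\pm\pi/\ln(q)$ going to the right and the vertical segment joining $-M-\frac{\pi\mathbf{i}}{\ln q}$ and $-M+\frac{\pi\mathbf{i}}{\ln q}$, with arbitrary $M$ such that $-M<\nu_1$; evaluating the integral as the sum of residues, $$F_\nu(x)=\prod_{j=0}^\infty\frac{1-q^{j+1}}{1-q^{j+1}x}\sum_{k=1}^\infty\frac{x^{\nu_k+k-1}}{\prod_{j\ne k}(1-q^{-\nu_k-k+1}q^{\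nu_j+j-1})}.$$
   Formalization: The printed F^(k) fails for k≥2 (k=2, λ=ν=0 gives −q/(1−q) instead of 1); here (−1)^{C(k,2)} is replaced by (q^{-1}(q^{-1}−1))^{C(k,2)} and both symbols (x_i q^{k−1};q)_∞ by (x_i q^k;q)_∞. *)

(* Defs.v *)
From HB Require Import structures.
From mathcomp Require Import all_boot all_order all_algebra.
From mathcomp Require Import perm complex.
From mathcomp Require Import all_classical all_reals all_analysis.

Set Implicit Arguments.
Unset Strict Implicit.
Unset Printing Implicit Defensive.

Import Order.TTheory GRing.Theory Num.Theory.
Import numFieldNormedType.Exports.

Local Open Scope classical_set_scope.
Local Open Scope ring_scope.

(* R[i] presented as a numClosedFieldType: the norm topology of
   mathcomp-analysis is attached to structures, not to the bare type R[i]. *)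
Definition cplx (R : realType) : numClosedFieldType := R[i].

(* The value at x of the continuous extension of f from its domain D (dense in
   all uses below), i.e. removable singularities are filled in. It is needed
   because division by 0 returns 0, so the quotients below are meaningless
   where a denominator vanishes. *)
Definition cont_ext (C : numClosedFieldType) (T : topologicalType)
    (D : set T) (f : T -> C) (x : T) : C :=
  lim (f y @[y --> within D (nbhs x)]).

Definition signature (N : nat) (lam : N.-tuple int) : Prop :=
  forall i j : 'I_N, (i <= j)%N -> tnth lam j <= tnth lam i.

Definition Delta (C : numClosedFieldType) (n : nat) (x : 'rV[C]_n) : C :=
  \prod_(i < n) \prod_(j < n | (i < j)%N) (x 0 i - x 0 j).

Definition distinct_nonzero (C : numClosedFieldType) (n : nat) :
    set 'rV[C]_n :=
  [set x | (forall i, x 0 i != 0) /\ (forall i j, i != j -> x 0 i != x 0 j)].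

(* Indices start at 0, so the exponent lambda_j + N - j reads N - j.+1. *)
Definition schur (C : numClosedFieldType) (N : nat) (lam : N.-tuple int) :
    'rV[C]_N -> C :=
  cont_ext (@distinct_nonzero C N)
    (fun u => \det (\matrix_(i < N, j < N)
                      (u 0 i) ^ (tnth lam j + (N - j.+1)%N%:Z))
              / Delta u).

Definition qPoch (C : numClosedFieldType) (q a : C) : C :=
  \big[*%R/1]_(0 <= i <oo) (1 - a * q ^+ i).

(* nu j stands for nu_{j+1}, so nu_k + k - 1 reads nu k + k. *)
Definition Fnu (C : numClosedFieldType) (q : C) (nu : nat -> int) : C -> C :=
  cont_ext [set x | x != 0 /\ forall j : nat, 1 - q ^+ j.+1 * x != 0]
    (fun x =>
      (\big[*%R/1]_(0 <= j <oo) ((1 - q ^+ j.+1) / (1 - q ^+ j.+1 * x))) *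
      \big[+%R/0]_(0 <= k <oo)
        (x ^ (nu k + k%:Z) /
         \big[*%R/1]_(0 <= j <oo | j != k)
           (1 - q ^ (- nu k - k%:Z) * q ^ (nu j + j%:Z)))).

(* The operator D_{i,p} on functions of k variables. *)
Definition qdiff (C : numClosedFieldType) (k : nat) (p : C) (i : 'I_k)
    (f : 'rV[C]_k -> C) : 'rV[C]_k -> C :=
  fun x =>
    (f (\row_j (if j == i then p * x 0 j else x 0 j)) - f x) / (p - 1).

(* The operator det[D_{i,p}^{j-1}], by the Leibniz formula; the product
   over i is composition, whose order is irrelevant as the D_{i,p} commute. *)
Definition det_qdiff (C : numClosedFieldType) (k : nat) (p : C)
    (f : 'rV[C]_k -> C) : 'rV[C]_k -> C :=
  fun x => \sum_(s : 'S_k)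
    (-1) ^+ s *
    foldr (fun (i : 'I_k) g => iter (s i) (qdiff p i) g) f (enum 'I_k) x.

(* The source prints the constant as (-1)^binom(k,2) q^(-2 binom(k,3)) and both
   q-Pochhammer symbols as (x_i q^(k-1); q)_oo. For k = 1 this agrees with the
   formula below, but for k >= 2 it is not the limit: for nu = 0 and k = 2,
   where the Schur ratio is identically 1 and Fnu = 1, it gives - q / (1 - q).
   The symbols must be (x_i q^k; q)_oo, coming from the nodes q^-k, q^-(k+1),
   ..., and the constant is then the one making F^(k) equal to 1 for nu = 0. *)
Definition Fnuk (C : numClosedFieldType) (q : C) (nu : nat -> int)
    (k : nat) : 'rV[C]_k -> C :=
  cont_ext
    [set x | distinct_nonzero x /\ forall i, qPoch q (x 0 i * q ^+ k) != 0]
    (fun x =>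
      (q^-1 * (q^-1 - 1)) ^+ 'C(k, 2) * q ^- (2 * 'C(k, 3)) /
      (Delta x * \prod_(i < k) qPoch q (x 0 i * q ^+ k)) *
      det_qdiff q^-1
        (fun y => \prod_(i < k)
           (Fnu q nu (y 0 i * q ^+ k.-1) * qPoch q (y 0 i * q ^+ k))) x).

(* The point (x_1, ..., x_k, q^-k, q^-(k+1), ..., q^(1-N)), for N >= k. *)
Definition spec_point (C : numClosedFieldType) (q : C) (k N : nat)
    (x : 'rV[C]_k) : 'rV[C]_N :=
  \row_(i < N)
    (if insub (i : nat) is Some j then x 0 (j : 'I_k) else q ^- i).

Definition schur_ratio (C : numClosedFieldType) (q : C) (k N : nat)
    (lam : N.-tuple int) (x : 'rV[C]_k) : C :=
  schur lam (spec_point q N x) / schur lam (\row_(i < N) q ^- i).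

(* Main.v *)
(* Write l_0 < l_1 < ... < l_(N-1) for the exponents lambda_j + N - j read from
   the bottom, c_j = prod_(i <> j) (1 - q^(l_i - l_j))^-1 and
   G_N(x) = sum_j c_j x^(l_j).  Lagrange interpolation at the nodes q^(-l_j) gives
   G_N(q^-s) = [s = 0] for s < N, so multiplying the alternant det(u_i^(l_j)) by
   the fixed matrix (c_j q^(m l_j)) turns the rows of the nodes u_i = q^-i, i >= k,
   into rows of a unitriangular matrix.  Hence the ratio of alternants is the
   k x k determinant det(G_N(x_i q^m)), and the Schur ratio is that determinant
   times a ratio of Vandermonde products.  The coefficients satisfy
   |c_j| <= B prod_(i < j) q^(l_j - l_i), which beats every r^(l_j); by Tannery's
   theorem G_N converges uniformly on compact sets to the series defining F_nu,
   and the Vandermonde products converge wherever no denominator vanishes.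

   The singularities are removed as follows: up to a monomial, the Schur ratio is
   a polynomial Q_N in x.  The formula gives uniform convergence of Q_N on a torus
   |x_i| = rho_i with distinct radii that avoid the powers of q^-1, and Cauchy's
   coefficient estimate (an average over roots of unity) propagates it to the
   polydisc inside.  The limit is thus continuous, and it agrees with the
   determinantal formula, i.e. with F^(k)_nu, on a dense set. *)
Require Import Defs.
From HB Require Import structures.
From mathcomp Require Import all_boot all_order all_algebra.
From mathcomp Require Import perm complex cyclic separable cyclotomic.
From mathcomp Require Import all_classical all_reals all_analysis.
From mathcomp Require Import ring lra zify.

Set Implicit Arguments.
Unset Strict Implicit.
Unset Printing Implicit Defensive.

Import Order.TTheory GRing.Theory Num.Theory.
Import numFieldNormedType.Exports.

Local Open Scope classical_set_scope.
Local Open Scope ring_scope.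

(** * The modulus of a complex number as a real number *)

Section Modulus.
Variable R : realType.
Local Notation C := (cplx R).

(** The hypothesis makes each exponent eventually constant, but from a rank that depends on its
    index; at stage N nothing is known of l_j for large j beyond the gap l_j - l_i >= j - i. The
    estimates therefore rest on this gap: the constant bounding the c_j depends neither on N nor on
    the exponents, and to beat r^(l_j) it is enough that finitely many of the lowest exponents have
    reached their limits. The link with F_nu is that G(q^-s) = 0 for s >= 1 survives in the limit.
    With exponents counted from the lowest one, the zeros of G match those of (xq;q)_oo, and F_nu(x)
    (xq;q)_oo = (q;q)_oo x^(nu 0) G(x) holds for every nonzero x, poles of the prefactor included.
    The operators D_(i,1/q) only combine values of this product along a geometric progression, by a
    triangular change of columns. The constant of F^(k) collects the determinant of that change, the
    sign of a reversal of columns, and the Vandermonde product of 1, q^-1, ..., q^(1-k). *)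

Definition cmod (z : C) : R := complex.Re (`|z| : R[i]).

Lemma cmodE (z : C) : `|z| = real_complex R (cmod z) :> C.
Proof. by rewrite /cmod [X in complex.Re X]normc_def /= [LHS]normc_def. Qed.

Lemma cmod_ge0 (z : C) : 0 <= cmod z.
Proof. by rewrite -ler0c -[X in _ <= X]cmodE; exact: normr_ge0. Qed.

Lemma cmodM (y z : C) : cmod (y * z) = cmod y * cmod z.
Proof. by apply: (@complexI R); rewrite rmorphM /= -!cmodE normrM. Qed.

Lemma cmodD (y z : C) : cmod (y + z) <= cmod y + cmod z.
Proof. by rewrite -lecR rmorphD /= -!cmodE; exact: ler_normD. Qed.

Lemma cmodN (z : C) : cmod (- z) = cmod z.
Proof. by apply: (@complexI R); rewrite -!cmodE normrN. Qed.

Lemma cmodC (y z : C) : cmod (y - z) = cmod (z - y).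
Proof. by rewrite -opprB cmodN. Qed.

Lemma cmodB (y z : C) : cmod (y - z) <= cmod y + cmod z.
Proof. by rewrite -(cmodN z) cmodD. Qed.

Lemma cmod_real (x : R) : cmod (real_complex R x) = `|x|.
Proof.
apply: (@complexI R); rewrite -cmodE.
by rewrite [LHS]normc_def /= expr0n /= addr0 sqrtr_sqr.
Qed.

Lemma cmod0 : cmod 0 = 0.
Proof. by rewrite -[0 in LHS](rmorph0 (real_complex R)) cmod_real normr0. Qed.

Lemma cmod1 : cmod 1 = 1.
Proof. by rewrite -[1 in LHS](rmorph1 (real_complex R)) cmod_real normr1. Qed.

Lemma cmod_i : cmod (Complex 0 1) = 1.
Proof.
apply: (@complexI R); rewrite -cmodE.
by rewrite [LHS]normc_def /= expr0n /= add0r expr1n sqrtr1.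
Qed.

Lemma cmod_eq0 (z : C) : (cmod z == 0) = (z == 0).
Proof.
by rewrite -(inj_eq (@complexI R)) -cmodE rmorph0 normr_eq0.
Qed.

Lemma cmod_gt0 (z : C) : (0 < cmod z) = (z != 0).
Proof. by rewrite lt_def cmod_ge0 andbT cmod_eq0. Qed.

Lemma cmodV (z : C) : cmod z^-1 = (cmod z)^-1.
Proof. by apply: (@complexI R); rewrite fmorphV /= -!cmodE normfV. Qed.

Lemma cmodX (z : C) n : cmod (z ^+ n) = cmod z ^+ n.
Proof. by apply: (@complexI R); rewrite rmorphXn /= -!cmodE normrX. Qed.

Lemma cmod_sum (I : Type) (s : seq I) (P : pred I) (F : I -> C) :
  cmod (\sum_(i <- s | P i) F i) <= \sum_(i <- s | P i) cmod (F i).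
Proof.
elim/big_ind2: _ => [|x a y b xa yb|//]; first by rewrite cmod0.
exact: le_trans (cmodD _ _) (lerD xa yb).
Qed.

Lemma cmod_prod (I : Type) (s : seq I) (P : pred I) (F : I -> C) :
  cmod (\prod_(i <- s | P i) F i) = \prod_(i <- s | P i) cmod (F i).
Proof. exact: (big_morph cmod cmodM cmod1). Qed.

Lemma cmodB_tri (x y z : C) : cmod (x - z) <= cmod (x - y) + cmod (y - z).
Proof. by rewrite -{1}(subrK y x) -addrA cmodD. Qed.

Lemma cmod_lerB (y z : C) : cmod y - cmod z <= cmod (y - z).
Proof. by rewrite lerBlDr -{1}(subrK z y) cmodD. Qed.

Lemma gt0_cplx (e : C) : 0 < e -> exists2 r : R, 0 < r & e = real_complex R r.
Proof.
case: e => a b; rewrite [_ < _]ltcE /= => /andP[/eqP -> a0].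
by exists a.
Qed.

Lemma cvg_cmodP (T : Type) (F : set_system T) (FF : Filter F) (f : T -> C) (l : C) :
  f @ F --> l <-> forall e : R, 0 < e -> \forall t \near F, cmod (f t - l) <= e.
Proof.
split=> [/cvgrPdist_le H e e0|H].
  have e0' : 0 < real_complex R e :> C by rewrite ltcR.
  near=> t; rewrite -lecR -cmodE distrC; near: t; exact: H e0'.
apply/cvgrPdist_le => e /gt0_cplx[r r0 ->].
near=> t; rewrite distrC cmodE lecR; near: t; exact: H.
Unshelve. all: by end_near. Qed.

Lemma nbhs_cmod (y : C) (e : R) : 0 < e -> nbhs y [set x : C | cmod (x - y) <= e].
Proof.
move=> e0; have /cvg_cmodP/(_ _ e0) H : id x @[x --> y] --> y by exact: cvg_id.
exact: H.
Qed.

(** Completeness is inherited from the reals coordinatewise: real and imaginary part are additive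
    and bounded by the modulus, the latter because Im z is, up to sign, the real part of iz. *)
Lemma cplx_cauchy (u : nat -> C) :
  (forall e : R, 0 < e -> exists N0, forall m n, (N0 <= m)%N -> (N0 <= n)%N ->
     cmod (u m - u n) <= e) ->
  exists l : C, u @ \oo --> l.
Proof.
move=> cu.
have key (h : C -> R) : (forall y z, h (y - z) = h y - h z) ->
    (forall z, `|h z| <= cmod z) -> cvg ((h \o u) @ \oo).
  move=> hB hle; apply/cauchy_cvgP/cauchy_exP => e e0.
  have e20 : 0 < e / 2 by rewrite divr_gt0.
  have [N0 HN] := cu _ e20.
  exists (h (u N0)); exists N0 => // n /= Nn.
  rewrite /ball /= -hB (le_lt_trans (hle _))//.
  by rewrite (le_lt_trans (HN _ _ _ _))// ltr_pdivrMr// ltr_pMr// ltr1n.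
have Rele (z : C) : `|complex.Re (z : R[i])| <= cmod z.
  by rewrite -lecR -[X in _ <= X]cmodE; exact: normc_ge_Re.
have Imle (z : C) : `|complex.Im (z : R[i])| <= cmod z.
  rewrite -[_ z]opprK normrN -(ReiNIm (z : R[i])).
  rewrite (le_trans (Rele _))// cmodM.
  by rewrite cmod_i mulr1.
have /cvg_ex[/= a ca] : cvg (((fun z : C => complex.Re (z : R[i])) \o u) @ \oo).
  by apply: key => // -[? ?] [? ?].
have /cvg_ex[/= b cb] : cvg (((fun z : C => complex.Im (z : R[i])) \o u) @ \oo).
  by apply: key => // -[? ?] [? ?].
exists (Complex a b : C); apply/cvg_cmodP => e e0.
have e20 : 0 < e / 2 by rewrite divr_gt0.
move/cvgrPdist_le : ca => /(_ _ e20) ca; move/cvgrPdist_le : cb => /(_ _ e20) cb.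
near=> n.
have -> : u n - (Complex a b : C) =
  (real_complex R (complex.Re (u n : R[i]) - a) : C) +
  (Complex 0 1 : C) * real_complex R (complex.Im (u n : R[i]) - b).
  case: (u n) => c d; apply/eqP; rewrite [_ == _]eq_complex /=.
  by apply/andP; split; apply/eqP; ring.
rewrite (le_trans (cmodD _ _))// cmodM !cmod_real (splitr e) lerD//.
  by rewrite distrC; near: n.
by rewrite cmod_i mul1r distrC; near: n.
Unshelve. all: by end_near. Qed.

End Modulus.

(** * Uniform convergence *)

Section UniformConvergence.
Variables (R : realType) (T : Type).
Local Notation C := (cplx R).
Implicit Types (A : set T) (f : nat -> T -> C) (g h : T -> C).

Definition ubd A g := exists B : R, forall x, A x -> cmod (g x) <= B.

(* Boundedness of the limit is included so that [ucv] is stable under products. *)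
Definition ucv A f g := ubd A g /\
  forall e : R, 0 < e ->
    \forall N \near \oo, forall x, A x -> cmod (f N x - g x) <= e.

Lemma ubd_cst A (c : C) : ubd A (fun=> c).
Proof. by exists (cmod c). Qed.

Lemma ubd_pos A g : ubd A g -> exists2 B : R, 0 < B & forall x, A x -> cmod (g x) <= B.
Proof.
move=> [B HB]; exists (`|B| + 1); first by rewrite ltr_wpDl.
move=> x /HB /le_trans; apply; rewrite (le_trans (ler_norm _))//.
by rewrite lerDl.
Qed.

Lemma ubdM A g h : ubd A g -> ubd A h -> ubd A (fun x => g x * h x).
Proof.
move=> [a Ha] /ubd_pos[b b0 Hb]; exists (a * b) => x Ax.
by rewrite cmodM ler_pM ?cmod_ge0 ?Ha ?Hb.
Qed.

Lemma ubd_prod A (I : Type) (s : seq I) (P : pred I) (G : I -> T -> C) :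
  (forall i, ubd A (G i)) -> ubd A (fun x => \prod_(i <- s | P i) G i x).
Proof.
move=> H; elim: s => [|i s [B HB]].
  by exists 1 => x _; rewrite big_nil cmod1.
have [a Ha] := ubdM (H i) (ex_intro _ B HB).
case Pi : (P i); [exists a|exists B] => x Ax; rewrite big_cons Pi.
  exact: Ha. exact: HB.
Qed.

Lemma ucv_cst A g : ubd A g -> ucv A (fun=> g) g.
Proof.
by move=> bg; split=> // e e0; near=> N => x _; rewrite subrr cmod0 ltW.
Unshelve. all: by end_near. Qed.

Lemma ucv_near A f f' g :
  (\forall N \near \oo, forall x, A x -> f N x = f' N x) -> ucv A f g -> ucv A f' g.
Proof.
move=> H [bg cv]; split=> // e /cv {}cv; near=> N => x Ax.
have <- : f N x = f' N x by move: x Ax; near: N.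
by move: x Ax; near: N.
Unshelve. all: by end_near. Qed.

Lemma ucv_ext A f g g' : (forall x, A x -> g x = g' x) -> ucv A f g -> ucv A f g'.
Proof.
move=> H [[B HB] cv]; split; first by exists B => x Ax; rewrite -H// HB.
by move=> e /cv; apply: filterS => N h x Ax; rewrite -H// h.
Qed.

Lemma ucv_sub A A' f g : A' `<=` A -> ucv A f g -> ucv A' f g.
Proof.
move=> s [[B HB] cv]; split; first by exists B => x /s; exact: HB.
by move=> e /cv; apply: filterS => N h x /s; exact: h.
Qed.

Lemma ucvD A f g f' g' : ucv A f g -> ucv A f' g' ->
  ucv A (fun N x => f N x + f' N x) (fun x => g x + g' x).
Proof.
move=> [[B HB] cv] [[B' HB'] cv']; split.
  by exists (B + B') => x Ax; rewrite (le_trans (cmodD _ _))// lerD ?HB ?HB'.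
move=> e e0; have e20 : 0 < e / 2 by rewrite divr_gt0.
near=> N => x Ax.
rewrite (_ : _ - _ = (f N x - g x) + (f' N x - g' x)); last by ring.
rewrite (le_trans (cmodD _ _))// (splitr e) lerD//.
  by move: x Ax; near: N; exact: cv.
by move: x Ax; near: N; exact: cv'.
Unshelve. all: by end_near. Qed.

Lemma ucvM A f g f' g' : ucv A f g -> ucv A f' g' ->
  ucv A (fun N x => f N x * f' N x) (fun x => g x * g' x).
Proof.
move=> [bg cv] [bg' cv']; split; first exact: ubdM.
have [B B0 HB] := ubd_pos bg; have [B' B'0 HB'] := ubd_pos bg'.
move=> e e0; have e1 : 0 < e / 2 / B by rewrite !divr_gt0.
have e2 : 0 < e / 2 / (B' + 1) by rewrite !divr_gt0// addr_gt0.
near=> N.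
have H1 : forall x, A x -> cmod (f N x - g x) <= e / 2 / (B' + 1).
  by near: N; exact: cv.
have H2 : forall x, A x -> cmod (f' N x - g' x) <= e / 2 / B.
  by near: N; exact: cv'.
have H3 : forall x, A x -> cmod (f' N x - g' x) <= 1.
  by near: N; exact: cv'.
move=> x Ax; have [h1 h2 h3] := And3 (H1 x Ax) (H2 x Ax) (H3 x Ax).
have h4 : cmod (f' N x) <= B' + 1.
  by rewrite -(subrK (g' x) (f' N x)) (le_trans (cmodD _ _))// addrC lerD// HB'.
rewrite (_ : _ - _ = (f N x - g x) * f' N x + g x * (f' N x - g' x)); last by ring.
rewrite (le_trans (cmodD _ _))// (splitr e) !cmodM lerD//.
  rewrite -[leRHS](@divfK _ (B' + 1)) ?gt_eqF ?addr_gt0//.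
  by rewrite ler_pM ?cmod_ge0.
rewrite -[leRHS](@divfK _ B) ?gt_eqF// mulrC.
by rewrite ler_pM ?cmod_ge0 ?HB.
Unshelve. all: by end_near. Qed.

Lemma ucv_sum A (I : Type) (s : seq I) (F : I -> nat -> T -> C) (G : I -> T -> C) :
  (forall i, ucv A (F i) (G i)) ->
  ucv A (fun N x => \sum_(i <- s) F i N x) (fun x => \sum_(i <- s) G i x).
Proof.
move=> H; elim: s => [|i s IH].
  apply: (@ucv_near _ (fun _ _ => 0)); first by near=> N => x _; rewrite big_nil.
  apply: (@ucv_ext _ _ (fun _ => 0)); first by move=> x _; rewrite big_nil.
  exact/ucv_cst/ubd_cst.
apply: (@ucv_near _ (fun N x => F i N x + \sum_(j <- s) F j N x)).
  by near=> N => x _; rewrite big_cons.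
apply: (@ucv_ext _ _ (fun x => G i x + \sum_(j <- s) G j x)).
  by move=> x _; rewrite big_cons.
exact: ucvD.
Unshelve. all: by end_near. Qed.

Lemma ucv_prod A (I : Type) (s : seq I) (F : I -> nat -> T -> C) (G : I -> T -> C) :
  (forall i, ucv A (F i) (G i)) ->
  ucv A (fun N x => \prod_(i <- s) F i N x) (fun x => \prod_(i <- s) G i x).
Proof.
move=> H; elim: s => [|i s IH].
  apply: (@ucv_near _ (fun _ _ => 1)); first by near=> N => x _; rewrite big_nil.
  apply: (@ucv_ext _ _ (fun _ => 1)); first by move=> x _; rewrite big_nil.
  exact/ucv_cst/ubd_cst.
apply: (@ucv_near _ (fun N x => F i N x * \prod_(j <- s) F j N x)).
  by near=> N => x _; rewrite big_cons.
apply: (@ucv_ext _ _ (fun x => G i x * \prod_(j <- s) G j x)).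
  by move=> x _; rewrite big_cons.
exact: ucvM.
Unshelve. all: by end_near. Qed.

Lemma ucv_det A n (F : nat -> T -> 'M[C]_n) (G : T -> 'M[C]_n) :
  (forall i j, ucv A (fun N x => F N x i j) (fun x => G x i j)) ->
  ucv A (fun N x => \det (F N x)) (fun x => \det (G x)).
Proof.
move=> H; rewrite /determinant; apply: ucv_sum => s.
apply: ucvM; first exact/ucv_cst/ubd_cst.
by apply: ucv_prod => i.
Qed.

Lemma ucv_cvg A f g x : ucv A f g -> A x -> f N x @[N --> \oo] --> g x.
Proof.
move=> [_ cv] Ax; apply/cvg_cmodP => e /cv.
by apply: filterS => N; exact.
Qed.

Lemma cmod_lim_le (u : nat -> C) (l : C) (b : R) : u n @[n --> \oo] --> l ->
  (\forall n \near \oo, cmod (u n) <= b) -> cmod l <= b.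
Proof.
move=> /cvg_cmodP cv H; apply/ler_addgt0Pr => e /cv {}cv.
near \oo => n.
rewrite -(subrK (u n) l) (le_trans (cmodD _ _))// addrC lerD//.
  by near: n.
by rewrite cmodC; near: n.
Unshelve. all: by end_near. Qed.

Lemma ucv_cauchy A f : (forall N, ubd A (f N)) ->
  (forall e : R, 0 < e -> exists N0, forall m n, (N0 <= m)%N -> (N0 <= n)%N ->
     forall x, A x -> cmod (f m x - f n x) <= e) ->
  ucv A f (fun x => lim (f N x @[N --> \oo])).
Proof.
move=> bf cf.
have cv x : A x -> f N x @[N --> \oo] --> lim (f N x @[N --> \oo]).
  move=> Ax; have [|l cl] := @cplx_cauchy R (f^~ x).
    by move=> e /cf[N0 H]; exists N0 => m n mN nN; exact: H.
  by rewrite (cvg_lim _ cl).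
have key e : 0 < e -> \forall N \near \oo,
    forall x, A x -> cmod (f N x - lim (f N x @[N --> \oo])) <= e.
  move=> /cf[N0 H]; exists N0 => // N /= NN0 x Ax.
  apply: (@cmod_lim_le (fun n => f N x - f n x)).
    by apply: cvgB; [exact: cvg_cst|exact: cv].
  by exists N0 => // n /= nN0; exact: H.
split=> //; near \oo => N; have [B HB] := bf N.
exists (B + 1) => x Ax; rewrite -(subrK (f N x) (lim _)) addrC.
rewrite (le_trans (cmodD _ _))// lerD ?HB// cmodC.
by move: x Ax; near: N; exact: key.
Unshelve. all: by end_near. Qed.

End UniformConvergence.

Lemma ucv_comp (R : realType) (T T' : Type) (A : set T) (A' : set T') (h : T' -> T)
    (f : nat -> T -> cplx R) g :
  (forall x, A' x -> A (h x)) -> ucv A f g -> ucv A' (fun N x => f N (h x)) (g \o h).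
Proof.
move=> s [[B HB] cv]; split; first by exists B => x /s; exact: HB.
by move=> e /cv; apply: filterS => N H x /s; exact: H.
Qed.

Lemma ucv_continuous (R : realType) (T : topologicalType) (A : set T)
    (f : nat -> T -> cplx R) (g : T -> cplx R) (x : T) :
  ucv A f g -> nbhs x A -> (forall N, {for x, continuous (f N)}) ->
  {for x, continuous g}.
Proof.
move=> [_ cv] Ax cf; apply/cvg_cmodP => e e0.
have e30 : 0 < e / 3 by rewrite divr_gt0.
near \oo => N.
have H : forall y, A y -> cmod (f N y - g y) <= e / 3 by near: N; exact: cv.
have := cf N; move/cvg_cmodP => /(_ _ e30) cN.
near=> y.
rewrite (_ : g y - g x = (g y - f N y) + ((f N y - f N x) + (f N x - g x))); last by ring.
rewrite (_ : e = e / 3 + (e / 3 + e / 3)); last by field.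
rewrite (le_trans (cmodD _ _))// lerD//.
  by rewrite cmodC H//; near: y.
rewrite (le_trans (cmodD _ _))// lerD//; first by near: y.
by apply: H; exact: nbhs_singleton.
Unshelve. all: by end_near. Qed.

(** * Tannery's theorem for sums and products *)

Section Tannery.
Variables (R : realType) (q : R).
Hypotheses (q0 : 0 < q) (q1 : q < 1).
Local Notation C := (cplx R).

Lemma sum_geo_le (M : R) (m n : nat) : 0 <= M ->
  \sum_(m <= j < n) M * q ^+ j <= M * q ^+ m / (1 - q).
Proof.
move=> M0; have p0 : 0 < 1 - q by rewrite subr_gt0.
have [mn|nm] := leqP m n; last first.
  by rewrite big_geq ?(ltnW nm)// divr_ge0 ?mulr_ge0 ?exprn_ge0// ltW.
rewrite ler_pdivlMr// -mulr_sumr -mulrA ler_wpM2l//.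
rewrite mulr_suml (eq_bigr (fun j => - (q ^+ j.+1 - q ^+ j))); last first.
  by move=> j _; rewrite exprS; ring.
by rewrite sumrN telescope_sumr// opprB gerBl exprn_ge0// ltW.
Qed.

Lemma cvg_geo0 (M : R) : M * q ^+ n @[n --> \oo] --> 0.
Proof.
rewrite -[0](mulr0 M); apply: cvgM; first exact: cvg_cst.
by apply: (cvg_expr (z := q)); rewrite ger0_norm// ltW.
Qed.

Lemma geo_small (M e : R) : 0 <= M -> 0 < e ->
  exists m, forall n, \sum_(m <= j < n) M * q ^+ j <= e.
Proof.
move=> M0 e0.
have := cvg_geo0 (M / (1 - q)) => /cvgrPdist_le/(_ _ e0)[m _ /(_ m (leqnn m))].
rewrite /= sub0r normrN => H; exists m => n.
apply: le_trans (sum_geo_le _ _ M0) _; apply: le_trans H.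
by rewrite (_ : M * q ^+ m / (1 - q) = M / (1 - q) * q ^+ m) ?ler_norm//; ring.
Qed.

Lemma cmod_sum_geo (u : nat -> C) (M : R) m n :
  (forall j, (m <= j < n)%N -> cmod (u j) <= M * q ^+ j) ->
  cmod (\sum_(m <= j < n) u j) <= \sum_(m <= j < n) M * q ^+ j.
Proof.
move=> H; apply: le_trans (cmod_sum _ _ _) _.
by rewrite big_seq [leRHS]big_seq; apply: ler_sum => j; rewrite mem_index_iota; exact: H.
Qed.

Lemma ucv_series (T : Type) (A : set T) (g : nat -> T -> C) (M : R) : 0 <= M ->
  (forall j x, A x -> cmod (g j x) <= M * q ^+ j) ->
  ucv A (fun n x => \sum_(0 <= j < n) g j x) (fun x => \big[+%R/0]_(0 <= j <oo) g j x).
Proof.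
move=> M0 H.
apply: (ucv_cauchy (f := fun n x => \sum_(0 <= j < n) g j x)) => [N|e e0].
  exists (\sum_(0 <= j < N) M * q ^+ j) => x Ax.
  by apply: cmod_sum_geo => j _; exact: H.
have [m Hm] := geo_small M0 e0; exists m => i j.
wlog : i j / (i <= j)%N => [W mi mj x Ax|ij mi mj x Ax].
  have [/W|/ltnW/W] := leqP i j; first exact.
  by move=> W'; rewrite cmodC W'.
rewrite (@big_cat_nat _ _ _ i 0 j)//= opprD addrA subrr add0r cmodN.
apply: le_trans (Hm j); apply: (le_trans (cmod_sum_geo _)) => [l _|]; first exact: H.
rewrite [leRHS](@big_cat_nat _ _ _ i m j)//= lerDr sumr_ge0// => l _.
by rewrite mulr_ge0// exprn_ge0// ltW.
Qed.

(** Domination is asked only for [j < N] and large [N], since a signature of size [N] has no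
    exponents beyond that. The second conclusion concerns partial sums of the limit series; it
    serves for the continuity of the limit and for the series defining F_nu. *)
Lemma tannery_sum (T : Type) (A : set T) (t : nat -> nat -> T -> C)
    (g : nat -> T -> C) (M : R) : 0 <= M ->
  (\forall N \near \oo, forall j, (j < N)%N -> forall x, A x ->
      cmod (t N j x) <= M * q ^+ j) ->
  (forall j, ucv A (fun N => t N j) (g j)) ->
  [/\ ucv A (fun N x => \sum_(0 <= j < N) t N j x)
          (fun x => \big[+%R/0]_(0 <= j <oo) g j x) &
      ucv A (fun N x => \sum_(0 <= j < N) g j x)
          (fun x => \big[+%R/0]_(0 <= j <oo) g j x)].
Proof.
move=> M0 H cv.
(* The limit terms inherit the bound, because a fixed [j] is eventually below [N]. *)
have Hg j x : A x -> cmod (g j x) <= M * q ^+ j.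
  move=> Ax; apply: (cmod_lim_le (ucv_cvg (cv j) Ax)).
  near=> N; have jN : (j < N)%N by near: N; exact: nbhs_infty_gt.
  move: (j) jN (x) Ax; near: N; exact: H.
have S := ucv_series M0 Hg; split=> //; split; first by case: S.
move=> e e0; have e30 : 0 < e / 3 by rewrite divr_gt0.
have [m Hm] := geo_small M0 e30.
have [_ cS] := ucv_sum (index_iota 0 m) cv.
have [_ /(_ _ e30) cG] := S.
have Htail : forall N, (m <= N)%N -> forall x, A x ->
    cmod (\sum_(0 <= j < N) g j x - \sum_(0 <= j < m) g j x) <= e / 3.
  move=> N mN x Ax; rewrite (@big_cat_nat _ _ _ m 0 N)//= addrAC subrr add0r.
  by apply: le_trans (Hm N); apply: cmod_sum_geo => j _; exact: Hg.
near=> N.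
have mN : (m <= N)%N by near: N; exact: nbhs_infty_ge.
have H1 : forall j, (j < N)%N -> forall x, A x -> cmod (t N j x) <= M * q ^+ j.
  by near: N; exact: H.
have H2 : forall x, A x ->
    cmod (\sum_(0 <= j < m) t N j x - \sum_(0 <= j < m) g j x) <= e / 3.
  by near: N; exact: cS.
move=> x Ax; set G := limn _.
rewrite (@big_cat_nat _ _ _ m 0 N)//=.
rewrite (_ : _ - G = \sum_(m <= j < N) t N j x +
  ((\sum_(0 <= j < m) t N j x - \sum_(0 <= j < m) g j x) +
  (\sum_(0 <= j < m) g j x - G))); last by ring.
rewrite (_ : e = e / 3 + (e / 3 + e / 3)); last by field.
rewrite (le_trans (cmodD _ _))// lerD//.
  apply: le_trans (Hm N); apply: cmod_sum_geo => j /andP[_ jN]; exact: H1.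
rewrite (le_trans (cmodD _ _))// lerD//; first exact: H2.
rewrite cmodC.
apply: (@cmod_lim_le _ (fun n => \sum_(0 <= j < n) g j x - \sum_(0 <= j < m) g j x)).
  by apply: cvgB; [exact: ucv_cvg S Ax|exact: cvg_cst].
near=> n; apply: Htail => //; near: n; exact: nbhs_infty_ge.
Unshelve. all: by end_near. Qed.

(* Turns a product into a series with geometrically small terms, so that the
   theorem for sums applies to products. *)
Lemma prod_telescope (u : nat -> C) n :
  \prod_(0 <= j < n) (1 + u j) =
  1 + \sum_(0 <= j < n) u j * \prod_(0 <= i < j) (1 + u i).
Proof.
elim: n => [|n IH]; first by rewrite !big_nil addr0.
by rewrite !big_nat_recr//= addrA -IH; ring.
Qed.

(** From 1 + a <= exp a, the constant is exp(M / (1 - q)). The quantifier order matters: one [B]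
    serves all sequences and all lengths, hence later all exponents, all N and all coefficients at
    once. *)
Lemma prod_geo_bounded (M : R) : 0 <= M ->
  exists2 B : R, 0 <= B & forall (u : nat -> C) n,
    (forall j, (j < n)%N -> cmod (u j) <= M * q ^+ j) ->
    cmod (\prod_(0 <= j < n) (1 + u j)) <= B.
Proof.
move=> M0; exists (expR (M * q ^+ 0 / (1 - q))) => [|u n H]; first exact: expR_ge0.
rewrite cmod_prod.
apply: (@le_trans _ _ (\prod_(0 <= j < n) expR (M * q ^+ j))).
  rewrite big_seq [leRHS]big_seq; apply: ler_prod => j; rewrite mem_index_iota => /andP[_ jn].
  rewrite cmod_ge0/= (le_trans (cmodD _ _))// cmod1 (le_trans _ (expR_ge1Dx _))//.
  by rewrite lerD2l H.
rewrite -(big_morph expR (@expRD R) (@expR0 R)) ler_expR.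
exact: sum_geo_le.
Qed.

Lemma tannery_prod (T : Type) (A : set T) (z : nat -> nat -> T -> C)
    (w : nat -> T -> C) (M : R) : 0 <= M ->
  (\forall N \near \oo, forall j, (j < N)%N -> forall x, A x ->
      cmod (z N j x) <= M * q ^+ j) ->
  (forall j, ucv A (fun N => z N j) (w j)) ->
  [/\ ucv A (fun N x => \prod_(0 <= j < N) (1 + z N j x))
          (fun x => \big[*%R/1]_(0 <= j <oo) (1 + w j x)) &
      ucv A (fun N x => \prod_(0 <= j < N) (1 + w j x))
          (fun x => \big[*%R/1]_(0 <= j <oo) (1 + w j x))].
Proof.
move=> M0 H cv; have [B B0 HB] := prod_geo_bounded M0.
have U1 : ucv A (fun _ _ => 1) (fun=> 1 : C) by exact/ucv_cst/ubd_cst.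
have MB0 : 0 <= M * B by rewrite mulr_ge0.
have [|j|S1 S2] := @tannery_sum T A
    (fun N j x => z N j x * \prod_(0 <= i < j) (1 + z N i x))
    (fun j x => w j x * \prod_(0 <= i < j) (1 + w i x)) (M * B) MB0.
- apply: filterS H => N H j jN x Ax; rewrite cmodM mulrAC ler_pM ?cmod_ge0//.
    exact: H.
  apply: HB => i ij; apply: H => //; exact: ltn_trans ij jN.
- by apply: ucvM => //; apply: ucv_prod => i; exact: ucvD.
have cvP := ucvD U1 S2.
have L x : A x -> \big[*%R/1]_(0 <= j <oo) (1 + w j x) =
    1 + \big[+%R/0]_(0 <= j <oo) (w j x * \prod_(0 <= i < j) (1 + w i x)).
  move=> Ax; apply: cvg_lim => //; have := ucv_cvg cvP Ax.
  apply: cvg_trans; apply: near_eq_cvg; near=> n.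
  by rewrite /= prod_telescope.
split; [have := ucvD U1 S1|have := cvP].
  move=> /(ucv_ext (fun x Ax => esym (L x Ax))); apply: ucv_near.
  by near=> N => x _; rewrite prod_telescope.
move=> /(ucv_ext (fun x Ax => esym (L x Ax))); apply: ucv_near.
by near=> N => x _; rewrite prod_telescope.
Unshelve. all: by end_near. Qed.

Lemma ucv_infprod (T : Type) (A : set T) (w : nat -> T -> C) (M : R) : 0 <= M ->
  (forall j x, A x -> cmod (w j x) <= M * q ^+ j) ->
  ucv A (fun N x => \prod_(0 <= j < N) (1 + w j x))
        (fun x => \big[*%R/1]_(0 <= j <oo) (1 + w j x)).
Proof.
move=> M0 H; have [|j|//] := @tannery_prod T A (fun=> w) w M M0.
  by near=> N => j _ x Ax; exact: H.
by apply: ucv_cst; exists (M * q ^+ j) => x; exact: H.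
Unshelve. all: by end_near. Qed.

(** Nonzero factors do not by themselves make an infinite product nonzero. The lower bound [d] lets
    1/(1 + w) be written 1 - w/(1 + w) with a deviation that is again geometrically small, so the
    product of reciprocals converges too, and the partial products multiply to 1. *)
Lemma infprod_inv (w : nat -> C) (M d : R) : 0 <= M -> 0 < d ->
  (forall j, cmod (w j) <= M * q ^+ j) -> (forall j, d <= cmod (1 + w j)) ->
  \big[*%R/1]_(0 <= j <oo) (1 + w j)^-1 * \big[*%R/1]_(0 <= j <oo) (1 + w j) = 1.
Proof.
move=> M0 d0 H Hd.
have nz j : 1 + w j != 0 by rewrite -cmod_gt0 (lt_le_trans d0).
have E j : (1 + w j)^-1 = 1 + - w j / (1 + w j) by have := nz j => ?; field.
have H' j : cmod (- w j / (1 + w j)) <= M / d * q ^+ j.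
  rewrite cmodM cmodN cmodV mulrAC ler_pM ?cmod_ge0 ?invr_ge0 ?cmod_ge0//.
  by rewrite lef_pV2 ?posrE// (lt_le_trans d0).
have Md0 : 0 <= M / d by rewrite divr_ge0// ltW.
have c1 := ucv_cvg (@ucv_infprod unit setT (fun j _ => - w j / (1 + w j)) _ Md0
  (fun j _ _ => H' j)) (I : setT tt).
have c2 := ucv_cvg (@ucv_infprod unit setT (fun j _ => w j) _ M0
  (fun j _ _ => H j)) (I : setT tt).
have -> : (fun n => \prod_(0 <= j < n) (1 + w j)^-1) =
          (fun n => \prod_(0 <= j < n) (1 + - w j / (1 + w j))).
  by apply/funext => n; apply: eq_bigr => j _.
apply: (cvg_unique (@norm_hausdorff _ _) (cvgM c1 c2)).
apply: cvg_near_cst; near=> n.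
transitivity ((\prod_(0 <= j < n) (1 + - w j / (1 + w j))) * \prod_(0 <= j < n) (1 + w j)) => //; rewrite -big_split big1//= => j _.
by rewrite -E mulVf.
Unshelve. all: by end_near. Qed.

End Tannery.

(** * Polynomial functions of several variables *)

Section PolynomialFunctions.
Variable F : numFieldType.

(** Closure of constants and coordinates under sum and product: continuity, boundedness, divided
    differences and restriction to curves all follow by induction on the construction, without
    coefficients or degrees. *)
Inductive polyfun (n : nat) : ('rV[F]_n -> F) -> Prop :=
| polyfun_cst c : polyfun (fun=> c)
| polyfun_coord i : polyfun (fun u => u 0 i)
| polyfunD f g : polyfun f -> polyfun g -> polyfun (fun u => f u + g u)
| polyfunM f g : polyfun f -> polyfun g -> polyfun (fun u => f u * g u).

Lemma polyfun_ext n (f g : 'rV[F]_n -> F) : f =1 g -> polyfun f -> polyfun g.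
Proof. by move=> /funext ->. Qed.

Lemma polyfunB n (f g : 'rV[F]_n -> F) :
  polyfun f -> polyfun g -> polyfun (fun u => f u - g u).
Proof.
move=> pf pg; apply: polyfunD => //.
apply: polyfun_ext (polyfunM (polyfun_cst _ (-1)) pg) => u.
by rewrite mulN1r.
Qed.

Lemma polyfun_sum n (I : Type) (s : seq I) (P : pred I) (f : I -> 'rV[F]_n -> F) :
  (forall i, polyfun (f i)) -> polyfun (fun u => \sum_(i <- s | P i) f i u).
Proof.
move=> H; elim: s => [|i s IH].
  by apply: polyfun_ext (polyfun_cst _ 0) => u; rewrite big_nil.
case Pi : (P i).
  by apply: polyfun_ext (polyfunD (H i) IH) => u; rewrite big_cons Pi.
by apply: polyfun_ext IH => u; rewrite big_cons Pi.
Qed.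

Lemma polyfun_prod n (I : Type) (s : seq I) (P : pred I) (f : I -> 'rV[F]_n -> F) :
  (forall i, polyfun (f i)) -> polyfun (fun u => \prod_(i <- s | P i) f i u).
Proof.
move=> H; elim: s => [|i s IH].
  by apply: polyfun_ext (polyfun_cst _ 1) => u; rewrite big_nil.
case Pi : (P i).
  by apply: polyfun_ext (polyfunM (H i) IH) => u; rewrite big_cons Pi.
by apply: polyfun_ext IH => u; rewrite big_cons Pi.
Qed.

Lemma polyfunX n (f : 'rV[F]_n -> F) m : polyfun f -> polyfun (fun u => f u ^+ m).
Proof.
move=> pf; elim: m => [|m IH]; first exact: polyfun_cst.
by apply: polyfun_ext (polyfunM pf IH) => u; rewrite exprS.
Qed.

Lemma polyfun_det n m (A : 'rV[F]_n -> 'M[F]_m) :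
  (forall i j, polyfun (fun u => A u i j)) -> polyfun (fun u => \det (A u)).
Proof.
move=> H; rewrite /determinant; apply: polyfun_sum => s.
by apply: polyfunM; [exact: polyfun_cst|exact: polyfun_prod].
Qed.

Lemma polyfun_comp n k (f : 'rV[F]_n -> F) (h : 'rV[F]_k -> 'rV[F]_n) :
  polyfun f -> (forall j, polyfun (fun x => h x 0 j)) -> polyfun (f \o h).
Proof.
move=> pf ph; elim: pf => [c|i|f1 f2 _ p1 _ p2|f1 f2 _ p1 _ p2].
- exact: polyfun_cst.
- exact: ph.
- exact: polyfunD p1 p2.
- exact: polyfunM p1 p2.
Qed.

(** Restriction to a polynomial curve is the bridge to one variable: it gives access to the
    finiteness of roots and to the one-variable Cauchy estimate. *)
Lemma polyfun_curve n (f : 'rV[F]_n -> F) (P : 'I_n -> {poly F}) :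
  polyfun f -> exists p : {poly F}, forall t, f (\row_j (P j).[t]) = p.[t].
Proof.
elim=> [c|i|f1 f2 _ [p1 H1] _ [p2 H2]|f1 f2 _ [p1 H1] _ [p2 H2]].
- by exists c%:P => t; rewrite hornerC.
- by exists (P i) => t; rewrite mxE.
- by exists (p1 + p2) => t; rewrite H1 H2 hornerD.
- by exists (p1 * p2) => t; rewrite H1 H2 hornerM.
Qed.

Lemma polyfun_continuous n (f : 'rV[F]_n -> F) : polyfun f -> continuous f.
Proof.
elim=> [c|i|f1 f2 _ c1 _ c2|f1 f2 _ c1 _ c2] u.
- exact: cst_continuous.
- exact: coord_continuous.
- by apply: continuousD; [exact: c1|exact: c2].
- by apply: continuousM; [exact: c1|exact: c2].
Qed.

Definition set_coord n (u : 'rV[F]_n) (i : 'I_n) (t : F) : 'rV[F]_n :=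
  \row_l (if l == i then t else u 0 l).

Lemma set_coord_id n (u : 'rV[F]_n) i : set_coord u i (u 0 i) = u.
Proof. by apply/rowP => l; rewrite mxE; case: eqP => [->|]. Qed.

(** Divided difference in the i-th coordinate. The product case is the discrete Leibniz rule, with
    the second factor at [u] and the first at the modified point. *)
Lemma polyfun_divdiff n (f : 'rV[F]_n -> F) i j : polyfun f ->
  exists2 g, polyfun g &
    forall u, f u - f (set_coord u i (u 0 j)) = (u 0 i - u 0 j) * g u.
Proof.
have pset l : polyfun (fun u => set_coord u i (u 0 j) 0 l).
  case: (eqVneq l i) => [->|ne].
    by apply: polyfun_ext (polyfun_coord j) => u; rewrite mxE eqxx.
  by apply: polyfun_ext (polyfun_coord l) => u; rewrite mxE (negPf ne).
elim=> [c|l|f1 f2 p1 [g1 pg1 H1] p2 [g2 pg2 H2]|f1 f2 p1 [g1 pg1 H1] p2 [g2 pg2 H2]].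
- by exists (fun=> 0) => [|u]; [exact: polyfun_cst|rewrite subrr mulr0].
- exists (fun=> (l == i)%:R) => [|u]; first exact: polyfun_cst.
  by rewrite mxE; case: eqP => [->|_]; rewrite ?mulr1 ?mulr0 ?subrr.
- exists (fun u => g1 u + g2 u) => [|u]; first exact: polyfunD.
  by rewrite mulrDr -H1 -H2; ring.
- exists (fun u => g1 u * f2 u + f1 (set_coord u i (u 0 j)) * g2 u) => [|u].
    apply: polyfunD; apply: polyfunM => //.
    exact: (polyfun_comp p1 pset).
  by rewrite mulrDr mulrA -H1 mulrCA -H2; ring.
Qed.

Lemma poly_zero_off0 (p : {poly F}) : (forall t, t != 0 -> p.[t] = 0) -> p = 0.
Proof.
move=> H; apply/eqP/negPn/negP => p0.
have := max_poly_roots p0 (rs := [seq i%:R | i <- iota 1 (size p)]).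
rewrite size_map size_iota ltnn => W; suff: false by []; apply: W.
  rewrite all_map; apply/allP => i; rewrite mem_iota => /andP[i0 _].
  by apply/rootP/H; rewrite pnatr_eq0 -lt0n.
rewrite map_inj_uniq ?iota_uniq// => a b /eqP; rewrite eqr_nat => /eqP//.
Qed.

(** The linear factors are divided out one at a time. The point is that the quotient [g] by u_i -
    u_j still vanishes where another pair p of coordinates coincides. Off the hyperplane u_i = u_j
    this is cancellation. On it, one coordinate outside p is moved along a line: the pair p stays
    equal while u_i and u_j separate, so [g] vanishes for all t <> 0 on this line, hence at t =
    0. *)
Lemma polyfun_div_pairs n (s : seq ('I_n * 'I_n)) (f : 'rV[F]_n -> F) :
  uniq s -> all (fun p : 'I_n * 'I_n => (p.1 < p.2)%N) s -> polyfun f ->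
  (forall p, p \in s -> forall u : 'rV_n, u 0 p.1 = u 0 p.2 -> f u = 0) ->
  exists2 g, polyfun g & forall u, f u = (\prod_(p <- s) (u 0 p.1 - u 0 p.2)) * g u.
Proof.
elim: s f => [|[i j] s IH] f /=.
  by move=> _ _ pf _; exists f => // u; rewrite big_nil mul1r.
move=> /andP[ns us] /andP[ij als] pf H.
have [g pg Hg] := polyfun_divdiff i j pf.
have fg u : f u = (u 0 i - u 0 j) * g u.
  rewrite -Hg [X in _ - X](H (i, j)) ?mem_head ?subr0//= !mxE eqxx.
  by case: eqP ij => [->|//]; rewrite ltnn.
have [|h ph Hh] := IH g us als pg.
  move=> p ps u up; have p12 := allP als p ps.
  (* An index among [i] and [j] that is not in the pair [p]; it exists because [p] and [(i, j)] are
     distinct increasing pairs. *)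
  pose a := if (i == p.1) || (i == p.2) then j else i.
  have [a1 a2 aij] : [/\ a != p.1, a != p.2 & (a == i) || (a == j)].
    rewrite /a; case: ifPn => [|/norP[]]; last by rewrite eqxx.
    have pij : p != (i, j) by apply: contraNneq ns => <-.
    rewrite eqxx orbT => /orP[] /eqP E; split=> //.
    - by rewrite -E neq_ltn ij orbT.
    - by apply: contraNneq pij => ->; rewrite E -surjective_pairing.
    - by rewrite neq_ltn (ltn_trans p12) ?orbT// -E.
    - by rewrite -E neq_ltn ij orbT.
  pose P l : {poly F} := if l == a then (u 0 l)%:P + 'X else (u 0 l)%:P.
  have PE t l : (\row_l (P l).[t]) 0 l = u 0 l + (l == a)%:R * t.
    by rewrite mxE /P; case: eqP; rewrite ?hornerE ?mul1r ?mul0r ?addr0.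
  have [r Hr] := polyfun_curve P pg.
  have [uij|uij] := eqVneq (u 0 i) (u 0 j); last first.
    have /eqP := fg u; rewrite (H p) ?inE ?ps ?orbT// eq_sym mulf_eq0 subr_eq0.
    by rewrite (negPf uij) => /eqP.
  have r0 : r = 0.
    apply: poly_zero_off0 => t t0; rewrite -Hr.
    have /eqP := fg (\row_l (P l).[t]); rewrite (H p) ?inE ?ps ?orbT//; last first.
      by rewrite !PE up ![p.1 == _]eq_sym ![p.2 == _]eq_sym (negPf a1) (negPf a2).
    rewrite eq_sym mulf_eq0 !PE uij => /orP[|/eqP//].
    have ji : j != i by rewrite neq_ltn ij orbT.
    case/orP: aij => /eqP ->; rewrite eqxx ?(negPf ji) ?[i == j]eq_sym ?(negPf ji).
      by rewrite mul1r mul0r addr0 addrAC subrr add0r (negPf t0).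
    by rewrite mul1r mul0r addr0 opprD addrA subrr add0r oppr_eq0 (negPf t0).
  have := Hr 0; rewrite r0 horner0 => <-; congr (g _).
  by apply/rowP => l; rewrite PE mulr0 addr0.
exists h => // u; by rewrite fg Hh big_cons mulrA.
Qed.

End PolynomialFunctions.

Lemma polyfun_div_Delta (F : numClosedFieldType) n (f : 'rV[F]_n -> F) : polyfun f ->
  (forall (u : 'rV_n) i j, i != j -> u 0 i = u 0 j -> f u = 0) ->
  exists2 g, polyfun g & forall u, f u = Delta u * g u.
Proof.
move=> pf H.
have [|||g pg Hg] := @polyfun_div_pairs F n
  [seq p : 'I_n * 'I_n <- index_enum _ | (p.1 < p.2)%N] f _ _ pf.
- by rewrite filter_uniq// index_enum_uniq.
- exact: filter_all.
- move=> p; rewrite mem_filter => /andP[p12 _] u; apply: H.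
  by rewrite neq_ltn p12.
exists g => // u; rewrite Hg big_filter /Delta.
by rewrite [in RHS]pair_big_dep.
Qed.

(** * Cauchy estimates for polynomials *)

Lemma prim_root_exists (F : numClosedFieldType) n : (0 < n)%N ->
  exists z : F, n.-primitive_root z.
Proof.
move=> n_gt0; have [r Dp] := closed_field_poly_normal ('X^n - 1 : {poly F}).
rewrite (monicP _) ?monicXnsubC// scale1r in Dp.
have rn1 : all n.-unity_root r.
  by apply/allP => z; rewrite -root_prod_XsubC -Dp.
have szr : (n < (size r).+1)%N.
  by rewrite -(size_prod_XsubC r id) -Dp size_XnsubC.
have [|z] := hasP (has_prim_root n_gt0 rn1 _ szr); last by exists z.
by rewrite -separable_prod_XsubC -Dp separable_Xn_sub_1// pnatr_eq0 -lt0n.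
Qed.

Section CauchyEstimate.
Variable R : realType.
Local Notation C := (cplx R).

Lemma prim_root_orth n (w : C) i j : n.-primitive_root w -> (i < n)%N -> (j < n)%N ->
  \sum_(s < n) (w ^+ j / w ^+ i) ^+ s = if i == j then n%:R else 0.
Proof.
move=> pw ilt jlt; have n0 := prim_order_gt0 pw.
have w0 : w != 0.
  apply/eqP => w0; have := prim_expr_order pw; rewrite w0 expr0n gtn_eqF//.
  by move=> /esym/eqP; rewrite oner_eq0.
case: eqP => [->|/eqP ne].
  rewrite divff ?expf_neq0// (eq_bigr (fun=> 1)); last by move=> s _; rewrite expr1n.
  by rewrite sumr_const card_ord.
set y := _ / _; have y1 : y - 1 != 0.
  rewrite subr_eq0; apply: contraNneq ne => /divr1_eq/eqP.
  by rewrite (eq_prim_root_expr pw) /= !modn_small// eq_sym.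
apply/eqP; rewrite -(mulrI_eq0 _ (mulfI y1)) -subrX1.
by rewrite expr_div_n -!exprM ![(_ * n)%N]mulnC !exprM (prim_expr_order pw) !expr1n divr1 subrr.
Qed.

Lemma cauchy_coef (p : {poly C}) (B rho : R) i : 0 < rho ->
  (forall t : C, cmod t = rho -> cmod p.[t] <= B) -> cmod p`_i * rho ^+ i <= B.
Proof.
(* The order of the root of unity exceeds both [i] and the degree, so that distinct powers of z
   occurring in the sum stay distinct and only the i-th coefficient survives the average. *)
move=> rho0 H; pose n := (size p + i).+1.
have [w pw] := prim_root_exists (cplx R) (ltn0Sn (size p + i)).
rewrite -/n in pw.
have cw : cmod w = 1.
  apply/eqP; rewrite -(@eqrXn2 _ n) ?cmod_ge0 ?ler01//.
  by rewrite -cmodX (prim_expr_order pw) cmod1 expr1n.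
have ltn_i : (i < n)%N by rewrite /n ltnS leq_addl.
pose z : C := real_complex R rho.
have cz : cmod z = rho by rewrite cmod_real gtr0_norm.
have E : n%:R * (p`_i * z ^+ i) = \sum_(s < n) p.[z * w ^+ s] * (w ^+ i) ^- s.
  under eq_bigr => s _.
    rewrite (@horner_coef_wide _ n) ?mulr_suml; last by rewrite /n leqW ?leq_addr.
    under eq_bigr => j _.
      rewrite (_ : _ * _ = p`_j * z ^+ j * (w ^+ j / w ^+ i) ^+ s); last first.
        by rewrite expr_div_n exprMn -!exprM [(s * j)%N]mulnC !mulrA.
      over.
    over.
  rewrite exchange_big/=.
  under eq_bigr => j _ do rewrite -mulr_sumr prim_root_orth//.
  rewrite (bigD1 (Ordinal ltn_i))//= eqxx big1 ?addr0 1?mulrC// => j.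
  by rewrite -(inj_eq val_inj)/= eq_sym => /negPf ->; rewrite mulr0.
have n0 : 0 < n%:R :> R by rewrite ltr0n.
rewrite -(ler_pM2l n0) (_ : n%:R * _ = cmod (n%:R * (p`_i * z ^+ i))); last first.
  rewrite !cmodM cmodX cz; congr (_ * _).
  by rewrite -(rmorph_nat (real_complex R)) cmod_real ger0_norm.
rewrite E (le_trans (cmod_sum _ _ _))//.
apply: (@le_trans _ _ (\sum_(s < n) B)); last first.
  by rewrite sumr_const card_ord mulr_natl.
apply: ler_sum => s _; rewrite cmodM cmodV !cmodX cw !expr1n invr1 mulr1.
by apply: H; rewrite cmodM cmodX cw expr1n mulr1.
Qed.

(** A weak maximum principle: summing the coefficient bounds gives a geometric series of ratio r /
    rho. The factor lost is harmless, as the radii stay fixed while N grows. *)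
Lemma cauchy_disc (p : {poly C}) (B r rho : R) (x : C) : 0 < r -> r < rho ->
  (forall t : C, cmod t = rho -> cmod p.[t] <= B) -> cmod x <= r ->
  cmod p.[x] <= B / (1 - r / rho).
Proof.
move=> r0 rrho H xr; have rho0 := lt_trans r0 rrho.
have B0 : 0 <= B.
  apply: (le_trans _ (cauchy_coef 0 rho0 H)); rewrite mulr_ge0 ?cmod_ge0//.
rewrite horner_coef (le_trans (cmod_sum _ _ _))//.
rewrite -(big_mkord xpredT (fun i => cmod (p`_i * x ^+ i))).
rewrite -[leRHS](mulr1 (B / _)) mulrAC -[1 in X in _ <= X](expr0 (r / rho)).
apply: (le_trans _ (sum_geo_le _ _ 0 (size p) B0)).
- apply: ler_sum => i _; rewrite cmodM cmodX expr_div_n mulrA.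
  rewrite ler_pdivlMr ?exprn_gt0// mulrAC.
  apply: ler_pM; rewrite ?mulr_ge0 ?exprn_ge0 ?cmod_ge0 ?(ltW rho0)//.
    exact: cauchy_coef.
  by rewrite lerXn2r// nnegrE ?cmod_ge0 ?ltW.
- by rewrite divr_gt0.
- by rewrite ltr_pdivrMr// mul1r.
Qed.

Lemma cauchy_polydisc k (f : 'rV[C]_k -> C) (B r : R) (rho : 'I_k -> R) :
  polyfun f -> 0 < r -> (forall i, r < rho i) ->
  (forall x : 'rV_k, (forall i, cmod (x 0 i) = rho i) -> cmod (f x) <= B) ->
  forall x : 'rV_k, (forall i, cmod (x 0 i) <= r) ->
    cmod (f x) <= B * \prod_i (1 - r / rho i)^-1.
Proof.
move=> pf r0 rrho H.
(* Coordinates are moved from circle to disc one at a time: here the first [m] lie in the disc and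
   the others are still on their circles. Each move costs one factor. *)
suff K m (x : 'rV_k) : (forall i : 'I_k, (i < m)%N -> cmod (x 0 i) <= r) ->
    (forall i : 'I_k, (m <= i)%N -> cmod (x 0 i) = rho i) ->
    cmod (f x) <= B * \prod_(i < k | (i < m)%N) (1 - r / rho i)^-1.
  move=> x Hx; have := K k x (fun i _ => Hx i).
  rewrite (eq_bigl _ _ (fun i : 'I_k => ltn_ord i : (i < k)%N = xpredT i)).
  by apply => i; rewrite leqNgt ltn_ord.
elim: m x => [|m IH] x H1 H2.
  by rewrite big_pred0 ?mulr1//; apply: H => i; exact: H2.
have [km|mk] := leqP k m.
  rewrite (eq_bigl (fun i : 'I_k => (i < m)%N)) => [|i]; last first.
    by have := ltn_ord i => ik; rewrite !(leq_trans ik)// leqW.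
  by apply: IH => i im; [apply: H1; rewrite leqW|have := ltn_ord i; rewrite ltnNge (leq_trans km im)].
pose i0 := Ordinal mk.
pose P l : {poly C} := if l == i0 then 'X else (x 0 l)%:P.
have [p Hp] := polyfun_curve P pf.
have PE t : (\row_l (P l).[t]) = set_coord x i0 t.
  by apply/rowP => l; rewrite !mxE /P; case: eqP; rewrite ?hornerE.
rewrite -(set_coord_id x i0) -PE Hp.
rewrite (bigD1 i0) ?ltnSn//= mulrCA mulrC.
rewrite (eq_bigl (fun i : 'I_k => (i < m)%N)) => [|i]; last first.
  by rewrite -(inj_eq val_inj) /= ltnS leq_eqVlt; case: ltngtP.
apply: cauchy_disc => // [t ct|]; last exact: H1.
rewrite -Hp PE; apply: IH => i im; rewrite mxE.
  case: eqP im => [->|_ im]; first by rewrite ltnn.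
  by apply: H1; rewrite leqW.
case: eqP => [->//|/eqP]; rewrite -(inj_eq val_inj)/= => ne.
by apply: H2; rewrite ltn_neqAle eq_sym ne.
Qed.

End CauchyEstimate.

(** * Alternants with nodes in geometric progression *)

Section Alternants.
Variable F : fieldType.

(** The Lagrange basis polynomial at the nodes 1/b_j is the product over i <> j of (1 - b_i t)/(1 -
    b_i/b_j); this is its value at t = 0. For b_j = q^(l_j) it is the c_j of the overview. *)
Definition lag n (b : 'I_n -> F) (j : 'I_n) : F :=
  \prod_(i < n | i != j) (1 - b i / b j)^-1.

(* Lagrange interpolation of [t ^ s] at the nodes [(b j)^-1], evaluated at [0]. *)
Lemma lag_sum n (b : 'I_n -> F) s : (forall i, b i != 0) -> injective b -> (s < n)%N ->
  \sum_j lag b j * (b j) ^- s = (s == 0%N)%:R.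
Proof.
move=> b0 bI sn.
pose L j : {poly F} := \prod_(i < n | i != j) (1 - b i *: 'X).
have LE j t : (L j).[t] = \prod_(i < n | i != j) (1 - b i * t).
  by rewrite horner_prod; apply: eq_bigr => i _; rewrite !hornerE.
have nz i j : i != j -> 1 - b i / b j != 0.
  by rewrite subr_eq0; apply: contraNneq => /esym/divr1_eq/bI ->.
pose f : {poly F} := \sum_j (lag b j * (b j) ^- s) *: L j.
have f0 : f = 'X^s.
  apply/eqP; rewrite -subr_eq0; apply/negPn/negP => ne.
  have := max_poly_roots ne (rs := [seq (b i)^-1 | i <- enum 'I_n]).
  rewrite size_map size_enum_ord ltnNge; have -> : (size (f - 'X^s)%R <= n)%N.
    rewrite (leq_trans (size_polyD _ _))// geq_max size_polyN size_polyXn sn andbT.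
    apply: (leq_trans (size_sum _ _ _)); apply/bigmax_leqP => j _.
    apply: (leq_trans (size_scale_leq _ _)).
    apply: (leq_trans (size_prod_leq _ _)).
    rewrite leq_subLR (@leq_trans (\sum_(i < n | i != j) 2).+1)//.
      rewrite ltnS; apply: leq_sum => i _.
      rewrite (leq_trans (size_polyD _ _))// geq_max size_poly1/= size_polyN.
      by rewrite (leq_trans (size_scale_leq _ _))// size_polyX.
    rewrite sum_nat_const; have := cardC1 j; rewrite card_ord.
    rewrite (_ : #|predC1 j| = #|(fun i : 'I_n => i != j)|)//.
    by move=> ->; case: n j {bI b0 sn LE nz L f ne b s} => [[]//|n _] /=; lia.
  move=> W; suff: false by []; apply: W.
    rewrite all_map; apply/allP => i _; apply/rootP.
    rewrite hornerD hornerN hornerXn horner_sum (bigD1 i)//= big1 => [|j ji].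
      rewrite hornerZ LE addr0 mulrAC /lag -big_split big1 ?mul1r ?exprVn ?subrr// => l li.
      by rewrite /= mulVf ?nz.
    by rewrite hornerZ LE (bigD1 i) 1?eq_sym//= divff// subrr mul0r mulr0.
  rewrite map_inj_uniq ?enum_uniq// => x y /invr_inj; exact: bI.
have := congr1 (fun p => p.[0]) f0; rewrite hornerXn expr0n => <-.
rewrite horner_sum; apply: eq_bigr => j _; rewrite hornerZ LE.
by rewrite [X in _ = _ * X]big1 ?mulr1// => i _; rewrite mulr0 subr0.
Qed.

Definition alternant n (e : 'I_n -> nat) (u : 'rV[F]_n) : 'M[F]_n :=
  \matrix_(i, j) u 0 i ^+ e j.

(** The function G_N of the overview. The exponents are natural numbers, the lowest one being split
    off beforehand, so this is a polynomial in [x]. *)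
Definition lagP n (q : F) (e : 'I_n -> nat) (x : F) : F :=
  \sum_j lag (fun j => q ^+ e j) j * x ^+ e j.

Lemma lagP_qV n (q : F) (e : 'I_n -> nat) s : q != 0 ->
  injective (fun j => q ^+ e j) -> (s < n)%N -> lagP q e (q ^- s) = (s == 0%N)%:R.
Proof.
move=> q0 qI sn; rewrite -(@lag_sum n (fun j => q ^+ e j))//; last first.
  by move=> i; rewrite expf_neq0.
by apply: eq_bigr => j _; rewrite exprVn -!exprM mulnC.
Qed.

Lemma det_unitrig n (A : 'M[F]_n) : (forall i j : 'I_n, (j <= i)%N -> A i j = (i == j)%:R) ->
  \det A = 1.
Proof.
move=> H; rewrite -det_tr det_trig; last first.
  by apply/is_trig_mxP => i j ij; rewrite mxE H ?(ltnW ij)// -(inj_eq val_inj) gtn_eqF.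
by rewrite big1// => i _; rewrite mxE H// eqxx.
Qed.

Definition lag_mx n (q : F) (e : 'I_n -> nat) : 'M[F]_n :=
  \matrix_(j, l) (lag (fun j => q ^+ e j) j * (q ^+ l) ^+ e j).

Lemma alternant_mul n (q : F) (e : 'I_n -> nat) (u : 'rV[F]_n) :
  alternant e u *m lag_mx q e = \matrix_(i, m) lagP q e (u 0 i * q ^+ m).
Proof.
apply/matrixP => i m; rewrite !mxE; apply: eq_bigr => j _; rewrite !mxE.
by rewrite exprMn mulrCA mulrA.
Qed.

Lemma lagP_qVM n (q : F) (e : 'I_n -> nat) i j : q != 0 ->
  injective (fun j => q ^+ e j) -> (i < n)%N -> (j <= i)%N ->
  lagP q e (q ^- i * q ^+ j) = (i == j)%:R.
Proof.
move=> q0 qI ik ji; have -> : q ^- i * q ^+ j = q ^- (i - j).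
  by rewrite -[in LHS](subnK ji) exprD invfM -mulrA mulVf ?mulr1// expf_neq0.
rewrite lagP_qV ?subn_eq0 1?eqn_leq ?ji ?andbT//.
exact: leq_ltn_trans (leq_subr _ _) ik.
Qed.

(** The determinant of [lag_mx] is never computed: it is the reciprocal of the alternant in the
    denominator of the Schur ratio, which is thereby shown to be nonzero. *)
Lemma det_alternant_nodes n (q : F) (e : 'I_n -> nat) : q != 0 ->
  injective (fun j => q ^+ e j) ->
  \det (alternant e (\row_i q ^- i)) * \det (lag_mx q e) = 1.
Proof.
move=> q0 qI; rewrite -det_mulmx alternant_mul; apply: det_unitrig => i j ji.
by rewrite !mxE lagP_qVM.
Qed.

(* Multiplying the alternant by [lag_mx q e] turns the rows of the nodes
   [q ^- i] into rows of a unitriangular matrix, so that only a k x k minor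
   survives. *)
Lemma det_alternant k m (q : F) (e : 'I_(k + m) -> nat) (u : 'rV[F]_(k + m)) :
  q != 0 -> injective (fun j => q ^+ e j) ->
  (forall i : 'I_m, u 0 (rshift k i) = q ^- (k + i)) ->
  \det (alternant e u) =
  \det (alternant e (\row_i q ^- i)) *
  \det (\matrix_(i < k, j < k) lagP q e (u 0 (lshift m i) * q ^+ j)).
Proof.
move=> q0 qI Hu; have E1 := det_alternant_nodes q0 qI.
suff <- : \det (alternant e u) * \det (lag_mx q e) =
    \det (\matrix_(i < k, j < k) lagP q e (u 0 (lshift m i) * q ^+ j)).
  by rewrite mulrCA E1 mulr1.
rewrite -det_mulmx alternant_mul -[X in \det X]submxK.
rewrite (_ : dlsubmx _ = 0); last first.
  apply/matrixP => i j; rewrite !mxE Hu lagP_qVM ?ltn_add2l//=.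
    by rewrite gtn_eqF// ltn_addr.
  by rewrite ltnW// ltn_addr.
rewrite det_ublock (det_unitrig (A := drsubmx _)) ?mulr1.
  by congr (\det _); apply/matrixP => i j; rewrite !mxE.
move=> i j ji; rewrite !mxE Hu lagP_qVM ?ltn_add2l ?leq_add2l//= eqn_add2l.
by rewrite -(inj_eq val_inj).
Qed.

End Alternants.

(** * Continuous extensions *)

(** The way every [cont_ext] of the statement is evaluated: exhibit a function continuous at the
    point that agrees with the raw quotient on the domain, and check that the point is adherent to
    the domain. *)
Lemma cont_ext_eq (C : numClosedFieldType) (T : topologicalType) (D : set T)
    (f g : T -> C) (x : T) :
  (forall y, D y -> f y = g y) -> {for x, continuous g} -> closure D x ->
  cont_ext D f x = g x.
Proof.
move=> fg cg clD; have PF := within_nbhs_proper clD.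
apply: cvg_lim; first exact: norm_hausdorff.
have cgD : g y @[y --> within D (nbhs x)] --> g x by exact: cvg_within_filter.
apply: cvg_trans cgD.
by apply: near_eq_cvg; rewrite near_withinE; near=> y => /fg.
Unshelve. all: by end_near. Qed.

Section Density.
Variable R : realType.
Local Notation C := (cplx R).

Lemma affine_neq0 (a b : C) : b != 0 ->
  \forall t \near (0 : R)^'+, a + real_complex R t * b != 0.
Proof.
move=> b0; have cb : 0 < cmod b by rewrite cmod_gt0.
have [->|a0] := eqVneq a 0.
  near=> t; rewrite add0r mulf_neq0// -cmod_gt0 cmod_real normr_gt0 gt_eqF//.
have ca : 0 < cmod a by rewrite cmod_gt0.
near=> t; have t0 : 0 < t by [].
have tb : t * cmod b < cmod a.
  by rewrite -ltr_pdivlMr//; near: t; apply: nbhs_right_lt; rewrite divr_gt0.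
rewrite -cmod_gt0 -[_ * _]opprK (lt_le_trans _ (cmod_lerB _ _))//.
by rewrite cmodN cmodM cmod_real gtr0_norm// subr_gt0.
Unshelve. all: by end_near. Qed.

(** The direction (1, 2, ..., n) has nonzero, pairwise distinct entries, so for small t > 0 all
    coordinates are nonzero and distinct, whatever the base point. *)
Definition rline n (x : 'rV[C]_n) (t : R) : 'rV[C]_n :=
  \row_i (x 0 i + real_complex R t * i.+1%:R).

Lemma closure_rline n (D : set 'rV[C]_n) (x : 'rV[C]_n) :
  (\forall t \near (0 : R)^'+, D (rline x t)) -> closure D x.
Proof.
move=> HD B /nbhs_ballP[_ /gt0_cplx[e e0 ->] HB].
have : \forall t \near (0 : R)^'+, (D `&` B) (rline x t).
  near=> t; split; first by near: t.
  apply: HB; split=> [|i j]; first by rewrite ltcR.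
  rewrite ord1 mxE /ball /= opprD addrA subrr add0r normrN.
  have t0 : 0 < t by [].
  rewrite normrM normr_nat cmodE cmod_real gtr0_norm//.
  rewrite -(rmorph_nat (real_complex R)) -rmorphM ltcR.
  rewrite (@le_lt_trans _ _ (t * n%:R))//; first by rewrite ler_pM2l// ler_nat.
  rewrite (@le_lt_trans _ _ (t * n.+1%:R))//; first by rewrite ler_pM2l// ler_nat.
  by rewrite -ltr_pdivlMr ?ltr0n//; near: t; apply: nbhs_right_lt; rewrite divr_gt0 ?ltr0n.
move=> H; near (0 : R)^'+ => t.
by exists (rline x t); near: t.
Unshelve. all: by end_near. Qed.

Lemma rline_distinct_nonzero n (x : 'rV[C]_n) :
  \forall t \near (0 : R)^'+, distinct_nonzero (rline x t).
Proof.
have H1 : \forall t \near (0 : R)^'+, forall i, rline x t 0 i != 0.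
  apply: filter_forall => i.
  have b0 : i.+1%:R != 0 :> C by rewrite pnatr_eq0.
  by apply: filterS (affine_neq0 (x 0 i) b0) => t; rewrite mxE.
have H2 : \forall t \near (0 : R)^'+, forall p : 'I_n * 'I_n,
    p.1 != p.2 -> rline x t 0 p.1 != rline x t 0 p.2.
  apply: filter_forall => -[i j] /=; have [->|ij] := eqVneq i j; first by near=> t.
  have b0 : i.+1%:R - j.+1%:R != 0 :> C by rewrite subr_eq0 eqr_nat eqSS.
  apply: filterS (affine_neq0 (x 0 i - x 0 j) b0) => t + _; apply: contraNneq.
  by rewrite !mxE mulrBr addrACA -opprD => ->; rewrite subrr.
near=> t; split; first by near: t.
by move=> i j; apply: (near H2 t _ (i, j)).
Unshelve. all: by end_near. Qed.

End Density.

(** * The ratio of Schur functions for finite N *)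

Section SchurFormula.
Variable R : realType.
Local Notation C := (cplx R).

Lemma continuous_prod (T : topologicalType) (I : Type) (s : seq I) (h : I -> T -> C) (u : T) :
  (forall i, {for u, continuous (h i)}) ->
  {for u, continuous (fun y => \prod_(i <- s) h i y)}.
Proof.
move=> H; elim: s => [|i s IH].
  rewrite (_ : (fun y => _) = (fun=> 1)); first exact: cst_continuous.
  by apply/funext => y; rewrite big_nil.
rewrite (_ : (fun y => _) = (fun y => h i y * \prod_(i <- s) h i y)).
  exact: (continuousM (H i) IH).
by apply/funext => y; rewrite big_cons.
Qed.

Lemma continuous_sum (T : topologicalType) (I : Type) (s : seq I) (h : I -> T -> C) (u : T) :
  (forall i, {for u, continuous (h i)}) ->
  {for u, continuous (fun y => \sum_(i <- s) h i y)}.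
Proof.
move=> H; elim: s => [|i s IH].
  rewrite (_ : (fun y => _) = (fun=> 0)); first exact: cst_continuous.
  by apply/funext => y; rewrite big_nil.
rewrite (_ : (fun y => _) = (fun y => h i y + \sum_(i <- s) h i y)).
  exact: (continuousD (H i) IH).
by apply/funext => y; rewrite big_cons.
Qed.

Lemma continuous_exprn (T : topologicalType) (h : T -> C) (u : T) n :
  {for u, continuous h} -> {for u, continuous (fun y => h y ^+ n)}.
Proof.
move=> ch; elim: n => [|n IH]; first exact: cst_continuous.
rewrite (_ : (fun y => _) = (fun y => h y * h y ^+ n)); first exact: (continuousM ch IH).
by apply/funext => y; rewrite exprS.
Qed.

Lemma continuous_exprz (T : topologicalType) (h : T -> C) (u : T) (l : int) : h u != 0 ->
  {for u, continuous h} -> {for u, continuous (fun y => h y ^ l)}.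
Proof.
move=> hu ch; case: l => n; first exact: continuous_exprn.
by apply: cvgV; [exact: expf_neq0|exact: continuous_exprn].
Qed.

Lemma Delta_neq0 n (u : 'rV[C]_n) : distinct_nonzero u -> Delta u != 0.
Proof.
move=> [_ H]; apply/prodf_neq0 => i _; apply/prodf_neq0 => j ij.
by rewrite subr_eq0 H// neq_ltn ij.
Qed.

(** [S] is the Schur polynomial, available also where coordinates collide and the quotient of
    determinants is meaningless. *)
Lemma alternant_Delta n (e : 'I_n -> nat) :
  exists2 S : 'rV[C]_n -> C, polyfun S &
    forall u, \det (alternant e u) = Delta u * S u.
Proof.
apply: polyfun_div_Delta => [|u i j ij uij].
  apply: polyfun_det => i j.
  have H : polyfun (fun u : 'rV[C]_n => u 0 i ^+ e j).
    exact: polyfunX (polyfun_coord _ i).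
  by apply: polyfun_ext H => u; rewrite mxE.
by apply: (determinant_alternate ij) => l; rewrite !mxE uij.
Qed.

(** Signature entries may be negative. Pulling u_i^l0 out of row i leaves natural exponents, so
    coinciding coordinates are dealt with by the polynomial [S] and only the monomial requires
    nonzero coordinates. *)
Lemma schurE n (lam : n.-tuple int) (l0 : int) (e : 'I_n -> nat) (S : 'rV[C]_n -> C)
    (u : 'rV[C]_n) :
  (forall j : 'I_n, tnth lam j + (n - j.+1)%N%:Z = l0 + (e j)%:Z) -> polyfun S ->
  (forall u, \det (alternant e u) = Delta u * S u) -> (forall i, u 0 i != 0) ->
  schur lam u = (\prod_i u 0 i ^ l0) * S u.
Proof.
move=> He pS HS u0.
rewrite /schur; apply: (cont_ext_eq (g := fun u : 'rV[C]_n => (\prod_i u 0 i ^ l0) * S u)).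
- move=> y yD; have [y0 _] := yD.
  apply: (mulIf (Delta_neq0 yD)); rewrite divfK ?Delta_neq0// -mulrA [S y * _]mulrC -HS.
  have <- : \det (diag_mx (\row_i (y 0 i ^ l0))) = \prod_i y 0 i ^ l0.
    by rewrite det_diag; apply: eq_bigr => i _; rewrite mxE.
  rewrite -det_mulmx mul_diag_mx; congr (\det _); apply/matrixP => i j.
  by rewrite !mxE He expfzDr.
- apply: continuousM; last exact: polyfun_continuous.
  by apply: continuous_prod => i; apply: continuous_exprz => //; exact: coord_continuous.
- exact/closure_rline/rline_distinct_nonzero.
Qed.

Lemma Delta_split k m (u : 'rV[C]_(k + m)) :
  Delta u = Delta (lsubmx u) *
    (\prod_(i < k) \prod_(j < m) (u 0 (lshift m i) - u 0 (rshift k j))) *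
    Delta (rsubmx u).
Proof.
rewrite /Delta big_split_ord/= -big_split/=; congr (_ * _).
  apply: eq_bigr => i _; rewrite big_split_ord/=; congr (_ * _).
    by apply: eq_bigr => j _; rewrite !mxE.
  by apply: eq_bigl => j; rewrite ltn_addr.
apply: eq_bigr => i _; rewrite big_split_ord/= big_pred0 ?mul1r.
  by apply: eq_big => [j|j _]; rewrite ?ltn_add2l// !mxE.
by move=> j; apply/negbTE; rewrite -leqNgt ltnW// ltn_addr.
Qed.

Variables (q : C) (k m : nat).
Hypothesis q0 : q != 0.

Lemma spec_point_lshift (x : 'rV[C]_k) (i : 'I_k) :
  spec_point q (k + m) x 0 (lshift m i) = x 0 i.
Proof.
rewrite mxE; case: insubP => [j _ /= ji|]; last by rewrite /= ltn_ord.
by congr (x 0 _); exact: val_inj.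
Qed.

Lemma spec_point_rshift (x : 'rV[C]_k) (i : 'I_m) :
  spec_point q (k + m) x 0 (rshift k i) = q ^- (k + i).
Proof. by rewrite mxE insubF//= ltnNge leq_addr. Qed.

Lemma polyfun_spec_point (f : 'rV[C]_(k + m) -> C) : polyfun f ->
  polyfun (f \o spec_point q (k + m) (k := k)).
Proof.
move=> pf; apply: polyfun_comp => // j.
case: (splitP j) => i /= ji.
  have -> : j = lshift m i by exact: val_inj.
  by apply: polyfun_ext (polyfun_coord _ i) => x; rewrite spec_point_lshift.
have -> : j = rshift k i by exact: val_inj.
by apply: polyfun_ext (polyfun_cst _ (q ^- (k + i))) => x; rewrite spec_point_rshift.
Qed.

(** [Q] is the Schur polynomial at the specialised point over its value at the nodes, and the
    monomial is the product of (x_i / q^-i)^l0. The last identity is kept multiplied out so as to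
    hold for every [x], including zeros of the Vandermonde products. *)
Lemma schur_ratioE (lam : (k + m).-tuple int) (l0 : int) (e : 'I_(k + m) -> nat) :
  (forall j : 'I_(k + m), tnth lam j + ((k + m) - j.+1)%N%:Z = l0 + (e j)%:Z) ->
  injective (fun j => q ^+ e j) ->
  exists Q : 'rV[C]_k -> C, [/\ polyfun Q,
    forall x : 'rV[C]_k, (forall i, x 0 i != 0) ->
      schur_ratio q lam x = (\prod_(i < k) (x 0 i * q ^+ i) ^ l0) * Q x &
    forall x : 'rV[C]_k, Q x * Delta x * (\prod_(i < k) \prod_(j < m) (x 0 i - q ^- (k + j))) =
      Delta (\row_(i < k) q ^- i) *
      (\prod_(i < k) \prod_(j < m) (q ^- i - q ^- (k + j))) *
      \det (\matrix_(i < k, j < k) lagP q e (x 0 i * q ^+ j))].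
Proof.
move=> He qI; have [S pS HS] := alternant_Delta e.
pose v : 'rV[C]_(k + m) := \row_i q ^- i.
have v0 i : v 0 i != 0 by rewrite mxE invr_neq0// expf_neq0.
have : Delta v * S v != 0.
  rewrite -HS; apply/eqP => d0; have := det_alternant_nodes q0 qI.
  by rewrite d0 mul0r => /eqP; rewrite eq_sym oner_eq0.
rewrite mulf_eq0 => /norP[Dv0 Sv0].
exists (fun x => (S v)^-1 * S (spec_point q (k + m) x)); split.
- exact: polyfunM (polyfun_cst _ _) (polyfun_spec_point pS).
- move=> x x0; rewrite /schur_ratio !(@schurE _ lam l0 e S)//; last first.
    move=> i; case: (splitP i) => j /= ij.
      by rewrite (_ : i = lshift m j) ?spec_point_lshift//; exact: val_inj.
    rewrite (_ : i = rshift k j) ?spec_point_rshift ?invr_neq0 ?expf_neq0//.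
    exact: val_inj.
  have E (w : 'rV[C]_(k + m)) : \prod_i w 0 i ^ l0 =
      (\prod_(i < k) w 0 (lshift m i) ^ l0) * \prod_(i < m) w 0 (rshift k i) ^ l0.
    exact: big_split_ord.
  rewrite !E.
  have -> : \prod_(i < k) spec_point q (k + m) x 0 (lshift m i) ^ l0 =
      (\prod_(i < k) (x 0 i * q ^+ i) ^ l0) * \prod_(i < k) v 0 (lshift m i) ^ l0.
    rewrite -big_split; apply: eq_bigr => i _ /=.
    by rewrite spec_point_lshift mxE -exprzMl ?unitfE ?invr_neq0 ?mulf_neq0 ?expf_neq0 ?mulfK ?expf_neq0//.
  have -> : \prod_(i < m) spec_point q (k + m) x 0 (rshift k i) ^ l0 =
      \prod_(i < m) v 0 (rshift k i) ^ l0.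
    by apply: eq_bigr => i _; rewrite spec_point_rshift mxE.
  have nz (I : finType) (h : I -> 'I_(k + m)) : \prod_i v 0 (h i) ^ l0 != 0.
    by apply/prodf_neq0 => i _; rewrite expfz_neq0.
  have := nz _ (@lshift k m); have := nz _ (@rshift k m).
  set a := \prod_(i < m) _; set b := \prod_(i < k) v _ _ ^ _ => a0 b0.
  by field; rewrite a0 b0 Sv0.
- move=> x.
  have := det_alternant q0 qI (spec_point_rshift x); rewrite !HS.
  rewrite -/v !Delta_split.
  have -> : lsubmx (spec_point q (k + m) x) = x.
    by apply/rowP => i; rewrite mxE spec_point_lshift.
  have -> : lsubmx v = \row_(i < k) q ^- i by apply/rowP => i; rewrite !mxE.
  have -> : rsubmx (spec_point q (k + m) x) = rsubmx v.
    by apply/rowP => i; rewrite mxE spec_point_rshift !mxE.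
  under eq_bigr => i _.
    under eq_bigr => j _ do rewrite spec_point_lshift spec_point_rshift.
    over.
  under [X in _ = _ * X * _ * _ * _]eq_bigr => i _.
    under eq_bigr => j _ do rewrite !mxE.
    over.
  under [in X in _ = _ * X]eq_mx => i j do rewrite spec_point_lshift.
  move: Dv0; rewrite Delta_split !mulf_eq0 => /norP[_ r0].
  set A := \prod_(i < k) _; set B := \prod_(i < k) _; set D := \det _ => E.
  apply: (mulIf r0); apply: (mulIf Sv0).
  transitivity (Delta x * A * Delta (rsubmx v) * S (spec_point q (k + m) x)).
    by field.
  by rewrite E; ring.
Qed.


End SchurFormula.

(** * Interpolation coefficients and their limits *)

Section Coefficients.
Variables (R : realType) (q : R).
Hypotheses (q0 : 0 < q) (q1 : q < 1).
Local Notation C := (cplx R).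
Let qc : C := real_complex R q.

Definition lag_factor (E : nat -> nat) (i k : nat) : C :=
  (1 - qc ^+ E i / qc ^+ E k)^-1.

(** Weak monotonicity of the signature becomes this gap once the staircase is added. It is imposed
    below [N] only, where the exponents are meaningful, and it makes the bounds below uniform in
    N. *)
Definition gapped (E : nat -> nat) (N : nat) :=
  forall i j : nat, (i <= j)%N -> (j < N)%N -> (E i + (j - i) <= E j)%N.

Lemma gapped_ge E N j : gapped E N -> (j < N)%N -> (j <= E j)%N.
Proof. by move=> gE /(gE 0 j (leq0n j)); rewrite subn0; apply: leq_trans; rewrite leq_addl. Qed.

Lemma qpow_le m n : (m <= n)%N -> q ^+ n <= q ^+ m.
Proof. by move=> mn; rewrite ler_wiXn2l// ltW. Qed.

Lemma qpow_lt1 n : (0 < n)%N -> 1 - q <= 1 - q ^+ n.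
Proof. by move=> n0; rewrite lerD2l lerN2 -[leRHS]expr1 qpow_le. Qed.

Lemma lag_factor_gt E i k : (E k < E i)%N ->
  lag_factor E i k - 1 = real_complex R (q ^+ (E i - E k) / (1 - q ^+ (E i - E k))).
Proof.
move=> ki; have p0 : 1 - q ^+ (E i - E k) != 0.
  by rewrite gt_eqF// subr_gt0 exprn_ilt1// ?ltW// subn_eq0 -ltnNge.
have -> : lag_factor E i k = real_complex R (1 - q ^+ (E i - E k))^-1.
  rewrite /lag_factor fmorphV rmorphB rmorph1 rmorphXn/=; congr (1 - _)^-1.
  rewrite -[in LHS](subnK (ltnW ki)) exprD mulfK// expf_neq0//.
  by rewrite fmorph_eq0 gt_eqF.
by rewrite -(rmorph1 (real_complex R)) -rmorphB; congr (real_complex R _); field.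
Qed.

(** For exponents below E k the factor is not close to 1 but small, of size about q^(E k - E i);
    these factors produce the decay of the coefficients. *)
Lemma lag_factor_lt E i k : (E i < E k)%N ->
  lag_factor E i k = real_complex R (- q ^+ (E k - E i) / (1 - q ^+ (E k - E i))).
Proof.
move=> ik; have p0 : 1 - q ^+ (E k - E i) != 0.
  by rewrite gt_eqF// subr_gt0 exprn_ilt1// ?ltW// subn_eq0 -ltnNge.
have qn0 n : q ^+ n != 0 by rewrite expf_neq0// gt_eqF.
rewrite /lag_factor -!rmorphXn -fmorphV -rmorphM -(rmorph1 (real_complex R)) -rmorphB -fmorphV.
congr (real_complex R _).
rewrite -[in LHS](subnK (ltnW ik)) exprD; have := qn0 (E i); have := qn0 (E k - E i)%N.
move: p0; set a := q ^+ (E k - E i); set b := q ^+ E i => p0 a0 b0; field.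
by rewrite p0 b0 a0 -opprB oppr_eq0 p0.
Qed.

(** For i > k the deviation from 1 is at most q^(i-k)/(1-q). For i < k it is 1/(1-q^d) with d = E k
    - E i, which is not small, but then q^(i-k) >= 1 and the same expression bounds it. *)
Lemma lag_factor_bound E N i k : gapped E N -> (i < N)%N -> (k < N)%N -> i != k ->
  cmod (lag_factor E i k - 1) <= q ^- k / (1 - q) * q ^+ i.
Proof.
move=> gE iN kN; have p0 : 0 < 1 - q by rewrite subr_gt0.
have qk0 : 0 < q ^+ k by rewrite exprn_gt0.
rewrite neq_ltn => /orP[ik|ki].
  have Eik : (E i < E k)%N.
    by apply: leq_trans (gE i k (ltnW ik) kN); rewrite -addn1 leq_add2l subn_gt0.
  rewrite lag_factor_lt// -(rmorph1 (real_complex R)) -rmorphB cmod_real.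
  have d0 : (0 < E k - E i)%N by rewrite subn_gt0.
  have h := qpow_lt1 d0; have h0 := lt_le_trans p0 h.
  rewrite (_ : _ - 1 = - (1 - q ^+ (E k - E i))^-1); last by field; rewrite gt_eqF.
  rewrite normrN ger0_norm ?invr_ge0 ?(ltW h0)// mulrAC.
  rewrite -[leLHS]mul1r ler_pM ?invr_ge0 ?(ltW h0)//.
    by rewrite mulrC ler_pdivlMr// mul1r qpow_le// ltnW.
  by rewrite lef_pV2.
have Eki := gE k i (ltnW ki) iN.
have lt : (E k < E i)%N by apply: leq_trans Eki; rewrite -addn1 leq_add2l subn_gt0.
rewrite lag_factor_gt// cmod_real.
have d0 : (0 < E i - E k)%N by rewrite subn_gt0.
have h := qpow_lt1 d0; have h0 := lt_le_trans p0 h.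
rewrite ger0_norm ?divr_ge0 ?exprn_ge0 ?(ltW h0) ?(ltW q0)//.
rewrite mulrAC ler_pM ?exprn_ge0 ?invr_ge0 ?(ltW h0) ?(ltW q0)//; last by rewrite lef_pV2.
rewrite mulrC ler_pdivlMr// -exprD qpow_le//.
by rewrite -leq_subLR in Eki *; move: Eki; rewrite leq_subLR; lia.
Qed.

Definition lag_coef (E : nat -> nat) (N k : nat) : C :=
  \prod_(0 <= i < N | i != k) lag_factor E i k.

Lemma lag_coef1p E N k : lag_coef E N k =
  \prod_(0 <= i < N) (1 + (if i != k then lag_factor E i k - 1 else 0)).
Proof.
rewrite /lag_coef big_mkcond/=; apply: eq_bigr => i _.
by case: ifP; rewrite ?addr0// addrC subrK.
Qed.

(** Factors with i > k form a product of geometrically small perturbations of 1. Those with i < k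
    have modulus q^d (1 + q^d/(1-q^d)) with d = E k - E i; once the q^d are extracted, what remains
    is a product of the same kind. Each part is bounded by [B], hence [B * B], independent of E, N
    and k. *)
Lemma lag_coef_bound : exists2 B : R, 0 <= B & forall E N k, gapped E N -> (k < N)%N ->
  cmod (lag_coef E N k) <= B * \prod_(0 <= i < k) q ^+ (E k - E i).
Proof.
have p0 : 0 < 1 - q by rewrite subr_gt0.
have M0 : 0 <= (1 - q)^-1 by rewrite invr_ge0 ltW.
have [B B0 HB] := prod_geo_bounded q0 q1 M0.
exists (B * B) => [|E N k gE kN]; first exact: mulr_ge0.
rewrite /lag_coef (@big_cat_nat _ _ _ k 0 N)//=; last exact: ltnW.
rewrite [X in _ * X]big_ltn_cond// eqxx/= cmodM mulrAC ler_pM ?cmod_ge0//; last first.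
  (* Shifting the index by k + 1 absorbs the q^-k of [lag_factor_bound], which would make the
     constant depend on k. *)
  rewrite -{1}[k.+1]add0n big_addn.
  rewrite (eq_big xpredT (fun i => 1 + (lag_factor E (i + k.+1) k - 1))) => [|i|i _].
  - apply: HB => i iN; have ikN : (i + k.+1 < N)%N by move: iN; lia.
    have ne : (i + k.+1)%N != k by rewrite gtn_eqF// leq_addl.
    apply: (le_trans (lag_factor_bound gE ikN kN ne)).
    rewrite mulrAC mulrC ler_wpM2l// addnS -addSn exprD mulrCA mulVf ?mulr1.
      by rewrite qpow_le.
    by rewrite expf_neq0// gt_eqF.
  - by rewrite gtn_eqF// leq_addl.
  - by rewrite addrC subrK.
rewrite cmod_prod.
have -> : B * \prod_(0 <= i < k) q ^+ (E k - E i) = \prod_(0 <= i < k) q ^+ (E k - E i) * B.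
  by rewrite mulrC.
have Hlt i : (i < k)%N -> (k - i <= E k - E i)%N.
  by move=> ik; have := gE i k (ltnW ik) kN; lia.
have step i : (0 <= i < k)%N -> cmod (lag_factor E i k) =
    q ^+ (E k - E i) * (1 + q ^+ (E k - E i) / (1 - q ^+ (E k - E i))).
  move=> /= ik; have d := Hlt i ik.
  have d0 : (0 < E k - E i)%N by apply: leq_trans d; rewrite subn_gt0.
  have h := qpow_lt1 d0; have h0 := lt_le_trans p0 h.
  have Eik : (E i < E k)%N by rewrite -subn_gt0.
  have pos : 0 <= q ^+ (E k - E i) / (1 - q ^+ (E k - E i)).
    by rewrite divr_ge0 ?exprn_ge0 ?(ltW h0) ?(ltW q0).
  rewrite (lag_factor_lt Eik) cmod_real mulNr normrN (ger0_norm pos).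
  by field; rewrite gt_eqF.
have -> : \prod_(0 <= i < k | i != k) cmod (lag_factor E i k) =
    (\prod_(0 <= i < k) q ^+ (E k - E i)) *
    \prod_(0 <= i < k) (1 + q ^+ (E k - E i) / (1 - q ^+ (E k - E i))).
  rewrite -big_split big_mkcond; apply: eq_big_nat => i ik /=.
  by rewrite step// ltn_eqF//; case/andP: ik.
rewrite ler_wpM2l//; first by apply: prodr_ge0 => i _; rewrite exprn_ge0 ?(ltW q0).
(* The differences E k - E i grow as i decreases, so the order is reversed to get terms bounded by a
   multiple of q^i. *)
rewrite big_nat_rev/= add0n.
pose u (i : nat) : C := real_complex R
  (q ^+ (E k - E (k - i.+1)%N) / (1 - q ^+ (E k - E (k - i.+1)%N))).
have ub i : (i < k)%N -> 0 <= q ^+ (E k - E (k - i.+1)%N) / (1 - q ^+ (E k - E (k - i.+1)%N))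
    <= (1 - q)^-1 * q ^+ i.
  move=> ik; have ki : (k - i.+1 < k)%N by lia.
  have d := Hlt _ ki; have d0 : (0 < E k - E (k - i.+1)%N)%N by lia.
  have h := qpow_lt1 d0; have h0 := lt_le_trans p0 h.
  rewrite divr_ge0 ?exprn_ge0 ?(ltW h0) ?(ltW q0)//= mulrC.
  rewrite ler_pM ?invr_ge0 ?exprn_ge0 ?(ltW h0) ?(ltW q0)//; first by rewrite lef_pV2.
  by apply: qpow_le; lia.
have := HB u k; rewrite cmod_prod (eq_big_nat _ _ (F2 := fun i =>
  1 + q ^+ (E k - E (k - i.+1)%N) / (1 - q ^+ (E k - E (k - i.+1)%N)))) => [|i /andP[_ ik]].
  by apply => i /ub/andP[ge le]; rewrite /u cmod_real ger0_norm.
have /andP[ge _] := ub i ik.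
rewrite /u -(rmorph1 (real_complex R)) -rmorphD cmod_real ger0_norm//.
by rewrite addr_ge0.
Qed.

End Coefficients.

Section Limits.
Variables (R : realType) (q : R).
Hypotheses (q0 : 0 < q) (q1 : q < 1).
Local Notation C := (cplx R).
Let qc : C := real_complex R q.
Variables (e : nat -> nat) (E : nat -> nat -> nat).
Hypotheses (ge : forall N, gapped e N) (gE : forall N, gapped (E N) N).
Hypothesis cE : forall j, \forall N \near \oo, E N j = e j.

Definition lag_lim (k : nat) : C := \big[*%R/1]_(0 <= i <oo | i != k) lag_factor q e i k.

Lemma lag_coef_ucv (T : Type) (A : set T) k :
  ucv A (fun N _ => lag_coef q (E N) N k) (fun=> lag_lim k) /\
  ucv A (fun N _ => lag_coef q e N k) (fun=> lag_lim k).
Proof.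
have p0 : 0 < 1 - q by rewrite subr_gt0.
have M0 : 0 <= q ^- k / (1 - q) by rewrite divr_ge0 ?invr_ge0 ?exprn_ge0 ?(ltW p0) ?(ltW q0).
pose z (F : nat -> nat) i (_ : T) : C := if i != k then lag_factor q F i k - 1 else 0.
have LE : (fun _ : T => lag_lim k) = (fun x => \big[*%R/1]_(0 <= i <oo) (1 + z e i x)).
  apply/funext => x; rewrite /lag_lim.
  have -> : (fun n => \prod_(0 <= i < n | i != k) lag_factor q e i k) =
      (fun n => \prod_(0 <= i < n) (1 + z e i x)) => //.
  by apply/funext => n; exact: (lag_coef1p q e n k).
rewrite LE.
have [||U1 U2] := @tannery_prod R q q0 q1 T A (fun N => z (E N)) (z e) _ M0.
- near=> N; have kN : (k < N)%N by near: N; exact: nbhs_infty_gt.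
  move=> j jN x _; rewrite /z; case: eqP => [_|/eqP jk] /=.
    by rewrite cmod0 mulr_ge0 ?exprn_ge0 ?(ltW q0).
  exact: (lag_factor_bound q0 q1 (@gE N) jN kN jk).
- move=> j; apply: (@ucv_near _ _ _ (fun=> z e j)).
    near=> N => x _; have Ej : E N j = e j by near: N; exact: cE.
    have Ek : E N k = e k by near: N; exact: cE.
    by rewrite /z /lag_factor Ej Ek.
  by apply: ucv_cst; rewrite /z; exact: ubd_cst.
by split; [apply: ucv_near U1|apply: ucv_near U2]; near=> N => x _; rewrite lag_coef1p.
Unshelve. all: by end_near. Qed.

Lemma qc_inj : injective (fun n => qc ^+ n).
Proof.
move=> m n; rewrite -!rmorphXn => /(@complexI R).
by apply: ieexprIn; rewrite // lt_eqF.
Qed.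

(** F_nu divides by an infinite product, whereas [lag_lim] is an infinite product of reciprocals;
    this identifies the two and shows that the divisor is nonzero. *)
Lemma lag_lim_inv k :
  \big[*%R/1]_(0 <= i <oo | i != k) (1 - qc ^+ e i / qc ^+ e k) * lag_lim k = 1.
Proof.
have p0 : 0 < 1 - q by rewrite subr_gt0.
have M0 : 0 <= q ^- k / (1 - q) by rewrite divr_ge0 ?invr_ge0 ?exprn_ge0 ?(ltW p0) ?(ltW q0).
pose w i : C := if i != k then lag_factor q e i k - 1 else 0.
have qn0 n : 0 < q ^+ n by rewrite exprn_gt0.
(* Each denominator has modulus at most 1 + q^(- e k), which bounds the reciprocal factors away from
   0. *)
have d0 : 0 < (1 + q ^- e k)^-1 by rewrite invr_gt0 addr_gt0 ?invr_gt0.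
have E1 i : 1 + w i = if i != k then lag_factor q e i k else 1.
  by rewrite /w; case: ifP; rewrite ?addr0// addrC subrK.
have := @infprod_inv R q q0 q1 w _ _ M0 d0; move=> H; rewrite -[RHS]H.
- have -> : (fun n => \prod_(0 <= j < n) (1 + w j)^-1) =
      (fun n => \prod_(0 <= i < n | i != k) (1 - qc ^+ e i / qc ^+ e k)).
    apply/funext => n; rewrite [RHS]big_mkcond; apply: eq_bigr => i _; rewrite E1 /lag_factor.
    by case: ifP; rewrite ?invrK ?invr1.
  have -> : (fun n => \prod_(0 <= j < n) (1 + w j)) =
      (fun n => \prod_(0 <= i < n | i != k) lag_factor q e i k) => //.
  by apply/funext => n; rewrite [RHS]big_mkcond; apply: eq_bigr => i _; rewrite E1.
- move=> j; rewrite /w; case: eqP => [_|/eqP jk] /=.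
    by rewrite cmod0 mulr_ge0 ?exprn_ge0 ?(ltW q0).
  apply: (lag_factor_bound q0 q1 (@ge (maxn j k).+1)) => //.
    by rewrite ltnS leq_maxl.
  by rewrite ltnS leq_maxr.
- move=> j; rewrite E1; have one : (1 + q ^- e k)^-1 <= 1.
    by rewrite invf_le1 ?lerDl ?invr_ge0 ?(ltW (qn0 _))// addr_gt0 ?invr_gt0.
  case: eqP => [_|/eqP jk] /=; first by rewrite cmod1.
  have nz : 1 - qc ^+ e j / qc ^+ e k != 0.
    rewrite subr_eq0 eq_sym; apply: contra jk => /eqP/divr1_eq/qc_inj h.
    have := @ge (maxn j k).+1 j k; have := @ge (maxn j k).+1 k j; lia.
  rewrite /lag_factor cmodV lef_pV2 ?posrE ?cmod_gt0// ?addr_gt0 ?invr_gt0//.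
  rewrite (le_trans (cmodB _ _))// cmod1 lerD2l cmodM cmodV !cmodX cmod_real gtr0_norm//.
  rewrite ler_piMl ?invr_ge0 ?(ltW (qn0 _))// -(expr0 q).
  exact: qpow_le.
Qed.

(** Columns of the alternant are numbered from the top of the signature, limits are taken from the
    bottom. *)
Lemma lagP_rev N (F : nat -> nat) (x : C) :
  lagP qc (fun j : 'I_N => F (N - j.+1)%N) x =
  \sum_(0 <= k < N) lag_coef q F N k * x ^+ F k.
Proof.
rewrite big_mkord (reindex_inj rev_ord_inj)/=; apply: eq_bigr => j _; congr (_ * _).
rewrite /lag_coef big_mkord (reindex_inj rev_ord_inj)/=; apply: eq_bigl => i.
by rewrite -[i == j](inj_eq rev_ord_inj) -(inj_eq val_inj).
Qed.

Definition lagP_lim (x : C) : C := \big[+%R/0]_(0 <= k <oo) (lag_lim k * x ^+ e k).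

(** Choose T with r q^T <= q and wait until the exponents of index at most T are frozen. For k >= T,
    keep only the first T factors of the bound on the coefficient: with s the sum of the first T
    exponents and E the k-th one, the term is at most B q^-s (r q^T)^E <= B q^-s q^E <= B q^-s q^k,
    whatever E is. For k < T the exponent is itself frozen. *)
Lemma lagP_ucv (r : R) : 1 <= r ->
  ucv [set x | cmod x <= r] (fun N x => \sum_(0 <= k < N) lag_coef q (E N) N k * x ^+ E N k)
      lagP_lim /\
  ucv [set x | cmod x <= r] (fun N x => \sum_(0 <= k < N) lag_lim k * x ^+ e k) lagP_lim.
Proof.
move=> r1; have r0 : 0 < r by exact: lt_le_trans r1.
have qn0 n : 0 < q ^+ n by rewrite exprn_gt0.
have [B B0 HB] := lag_coef_bound q0 q1.
have [T HT] : exists T, r * q ^+ T <= q.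
  have /cvgrPdist_le/(_ _ q0)[T _ /(_ T (leqnn T))] := cvg_geo0 q0 q1 r.
  by rewrite /= sub0r normrN => /(le_trans (ler_norm _)); exists T.
pose s := (\sum_(0 <= i < T) e i)%N.
(* The first summand dominates the terms with k >= T. The second handles k < T, where r >= 1 gives
   r^(e k) <= r^(e T), and q^-T q^k >= 1. *)
pose M := B * (q ^- s + r ^+ e T * q ^- T).
have M1 : 0 <= q ^- s by rewrite invr_ge0 ltW.
have M2 : 0 <= r ^+ e T * q ^- T by rewrite mulr_ge0 ?invr_ge0 ?exprn_ge0 ?(ltW r0) ?(ltW q0).
have M0 : 0 <= M by rewrite mulr_ge0// addr_ge0.
pose t N k (x : C) := lag_coef q (E N) N k * x ^+ E N k.
have eqT : \forall N \near \oo, forall i : 'I_T.+1, E N i = e i.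
  by apply: filter_forall => i; exact: cE.
have bnd : \forall N \near \oo, forall k, (k < N)%N -> forall x,
    [set x | cmod x <= r] x -> cmod (t N k x) <= M * q ^+ k.
  near=> N; have TN : (T < N)%N by near: N; exact: nbhs_infty_gt.
  have Ee i : (i <= T)%N -> E N i = e i.
    move=> iT; have H : forall i : 'I_T.+1, E N i = e i by near: N.
    exact: (H (Ordinal (iT : (i < T.+1)%N))).
  move=> k kN x /= xr; rewrite cmodM cmodX.
  have -> : M * q ^+ k = B * ((q ^- s + r ^+ e T * q ^- T) * q ^+ k) by rewrite mulrA.
  apply: (@le_trans _ _ (B * ((\prod_(0 <= i < k) q ^+ (E N k - E N i)) * r ^+ E N k))).
    rewrite mulrA ler_pM ?exprn_ge0 ?cmod_ge0//; first exact: HB.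
    by rewrite lerXn2r// nnegrE ?cmod_ge0 ?(ltW r0).
  rewrite ler_wpM2l// mulrDl.
  have prod1 a b : \prod_(a <= i < b) q ^+ (E N k - E N i) <= 1.
    by apply: prodr_ile1 => i _; rewrite exprn_ge0 ?exprn_ile1 ?(ltW q0) ?(ltW q1).
  have prod0 a b : 0 <= \prod_(a <= i < b) q ^+ (E N k - E N i).
    by apply: prodr_ge0 => i _; rewrite exprn_ge0 ?(ltW q0).
  have [kT|Tk] := ltnP k T.
    apply: (@le_trans _ _ (r ^+ e T * q ^- T * q ^+ k)); last first.
      by rewrite lerDr mulr_ge0// exprn_ge0// ltW.
    apply: (@le_trans _ _ (1 * r ^+ e T)).
      rewrite ler_pM ?exprn_ge0 ?(ltW r0)// Ee 1?ltnW// ler_weXn2l//.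
      by have := @ge T.+1 k T (ltnW kT) (ltnSn T); lia.
    rewrite mul1r -mulrA ler_peMr ?exprn_ge0 ?(ltW r0)//.
    by rewrite mulrC ler_pdivlMr// mul1r qpow_le// ltnW.
  apply: (@le_trans _ _ (q ^- s * q ^+ k)); last first.
    by rewrite lerDl mulr_ge0// exprn_ge0// ltW.
  have PT : \prod_(0 <= i < T) q ^+ (E N k - E N i) = q ^- s * (q ^+ E N k) ^+ T.
    have -> : q ^- s = \prod_(0 <= i < T) q ^- e i.
      apply: (big_morph (fun n => q ^- n)); last by rewrite expr0 invr1.
      by move=> a b; rewrite exprD invfM.
    rewrite -[T in _ ^+ T]subn0 -prodr_const_nat -big_split.
    apply: eq_big_nat => i /andP[_ iT] /=; rewrite (Ee i (ltnW iT)).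
    have eik : (e i <= E N k)%N.
      by rewrite -(Ee i (ltnW iT)); have := @gE N i k (leq_trans (ltnW iT) Tk) kN; lia.
    by rewrite -[in RHS](subnK eik) exprD mulrCA mulVf ?mulr1// gt_eqF.
  rewrite (@big_cat_nat _ _ _ T 0 k)//= PT.
  apply: (@le_trans _ _ (q ^- s * (q ^+ E N k) ^+ T * 1 * r ^+ E N k)).
    by rewrite ler_wpM2r ?exprn_ge0 ?(ltW r0)// ler_wpM2l// mulr_ge0// !exprn_ge0 ?(ltW q0).
  rewrite mulr1 -!mulrA ler_wpM2l// -exprM mulnC exprM -exprMn [_ * r]mulrC.
  apply: (@le_trans _ _ (q ^+ E N k)).
    by rewrite lerXn2r ?nnegrE ?mulr_ge0 ?exprn_ge0 ?(ltW q0) ?(ltW r0).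
  by apply: qpow_le => //; exact: (gapped_ge (@gE N)).
have [k|U1 U2] := @tannery_sum R q q0 q1 C _ t (fun k x => lag_lim k * x ^+ e k) M M0 bnd.
- apply: ucvM; first by case: (lag_coef_ucv [set x | cmod x <= r] k).
  apply: (@ucv_near _ _ _ (fun _ x => x ^+ e k)).
    by near=> N => x _; have -> : E N k = e k by near: N; exact: cE.
  apply: ucv_cst; exists (r ^+ e k) => x xr; rewrite cmodX.
  by rewrite lerXn2r// nnegrE ?cmod_ge0 ?(ltW r0).
by split.
Unshelve. all: by end_near. Qed.

End Limits.

(** * Uniform convergence on polydiscs *)

Lemma ucv_subn (R : realType) (T : Type) (A : set T) (f : nat -> T -> cplx R) g k :
  ucv A f g -> ucv A (fun N => f (N - k)%N) g.
Proof.
move=> [bg cv]; split=> // e /cv[N0 _ H]; exists (N0 + k)%N => // N /= h.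
by apply: H => /=; rewrite leq_subRL ?(leq_trans (leq_addl _ _) h)// addnC.
Qed.

Section QLimit.
Variables (R : realType) (q : R).
Hypotheses (q0 : 0 < q) (q1 : q < 1).
Local Notation C := (cplx R).
Let qc : C := real_complex R q.
Variables (e : nat -> nat) (E : nat -> nat -> nat).
Hypotheses (ge : forall N, gapped e N) (gE : forall N, gapped (E N) N).
Hypothesis cE : forall j, \forall N \near \oo, E N j = e j.
Variable k : nat.

Definition good_set (r d : R) : set 'rV[C]_k :=
  [set x : 'rV[C]_k | [/\ forall i, cmod (x 0 i) <= r, d <= cmod (Delta x) &
               forall i (j : nat), d <= cmod (1 - x 0 i * qc ^+ (k + j))]].

(** The quotient of q^-i - q^-(k+j) by x_i - q^-(k+j), both multiplied by -q^(k+j) so that numerator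
    and denominator tend to 1 as j grows. *)
Definition ratio_factor (x : 'rV[C]_k) (i : 'I_k) (j : nat) : C :=
  (1 - qc ^+ (k + j) / qc ^+ i) / (1 - x 0 i * qc ^+ (k + j)).

Definition ratio_lim (x : 'rV[C]_k) : C :=
  Delta (\row_(i < k) qc ^- i) / Delta x *
  (\prod_i \big[*%R/1]_(0 <= j <oo) ratio_factor x i j) *
  \det (\matrix_(i < k, j < k) lagP_lim q e (x 0 i * qc ^+ j)).

Lemma qc_neq0 : qc != 0.
Proof. by rewrite fmorph_eq0 gt_eqF. Qed.

Lemma cmod_qcX n : cmod (qc ^+ n) = q ^+ n.
Proof. by rewrite cmodX cmod_real gtr0_norm. Qed.

Lemma ucv_ratio_factor r d (i : 'I_k) : 0 <= r -> 0 < d ->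
  ucv (good_set r d) (fun N x => \prod_(0 <= j < N) ratio_factor x i j)
    (fun x => \big[*%R/1]_(0 <= j <oo) ratio_factor x i j).
Proof.
move=> r0 d0.
have M0 : 0 <= (r + q ^- i) / d.
  by rewrite divr_ge0 ?addr_ge0 ?invr_ge0 ?exprn_ge0 ?(ltW q0) ?(ltW d0).
pose w j (x : 'rV[C]_k) : C := ratio_factor x i j - 1.
have E1 x j : 1 + w j x = ratio_factor x i j by rewrite addrC subrK.
have := @ucv_infprod R q q0 q1 'rV[C]_k (good_set r d) w _ M0.
have -> : (fun N x => \prod_(0 <= j < N) (1 + w j x)) =
    (fun N x => \prod_(0 <= j < N) ratio_factor x i j).
  by apply/funext => N; apply/funext => x; apply: eq_bigr => j _; rewrite E1.
have -> : (fun x => \big[*%R/1]_(0 <= j <oo) (1 + w j x)) =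
    (fun x => \big[*%R/1]_(0 <= j <oo) ratio_factor x i j).
  apply/funext => x.
  have -> // : (fun n => \prod_(0 <= j < n) (1 + w j x)) =
    (fun n => \prod_(0 <= j < n) ratio_factor x i j).
  by apply/funext => n; apply: eq_bigr => j _; rewrite E1.
apply=> j x [xr _ xd].
have nz : 1 - x 0 i * qc ^+ (k + j) != 0 by rewrite -cmod_gt0 (lt_le_trans d0).
have qi0 : qc ^+ i != 0 by rewrite expf_neq0// qc_neq0.
have -> : w j x = qc ^+ (k + j) * (x 0 i - qc ^- i) / (1 - x 0 i * qc ^+ (k + j)).
  by rewrite /w /ratio_factor; field; rewrite nz qi0.
rewrite !cmodM cmodV cmod_qcX mulrAC -mulrA mulrC.
rewrite ler_pM ?mulr_ge0 ?invr_ge0 ?cmod_ge0 ?exprn_ge0 ?(ltW q0)//; last first.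
  by apply: qpow_le => //; rewrite leq_addl.
rewrite mulrC ler_pM ?cmod_ge0 ?invr_ge0 ?cmod_ge0//.
  rewrite (le_trans (cmodB _ _))// lerD// cmodV cmod_qcX//.
by rewrite lef_pV2 ?posrE ?cmod_gt0.
Qed.

Variable Q : nat -> 'rV[C]_k -> C.
Hypothesis pQ : forall N, polyfun (Q N).
Hypothesis HQ : \forall N \near \oo, forall x : 'rV[C]_k,
  Q N x * Delta x * (\prod_(i < k) \prod_(j < N - k) (x 0 i - qc ^- (k + j))) =
  Delta (\row_(i < k) qc ^- i) *
  (\prod_(i < k) \prod_(j < N - k) (qc ^- i - qc ^- (k + j))) *
  \det (\matrix_(i < k, j < k) lagP qc (fun j : 'I_N => E N (N - j.+1)%N) (x 0 i * qc ^+ j)).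

Lemma Q_ucv_good r d : 1 <= r -> 0 < d -> ucv (good_set r d) Q ratio_lim.
Proof.
move=> r1 d0; have r0 : 0 <= r by apply: le_trans r1.
pose f N (x : 'rV[C]_k) : C := Delta (\row_(i < k) qc ^- i) / Delta x *
  (\prod_i \prod_(0 <= j < N - k) ratio_factor x i j) *
  \det (\matrix_(i < k, j < k)
     \sum_(0 <= l < N) lag_coef q (E N) N l * (x 0 i * qc ^+ j) ^+ E N l).
apply: (@ucv_near _ _ _ f).
  apply: filterS HQ => N H x [xr xD xd].
  have D0 : Delta x != 0 by rewrite -cmod_gt0 (lt_le_trans d0).
  have qn0 n : qc ^+ n != 0 by rewrite expf_neq0// qc_neq0.
  have nz i (j : nat) : 1 - x 0 i * qc ^+ (k + j) != 0.
    by rewrite -cmod_gt0 (lt_le_trans d0).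
  have P0 : \prod_(i < k) \prod_(j < N - k) (x 0 i - qc ^- (k + j)) != 0.
    apply/prodf_neq0 => i _; apply/prodf_neq0 => j _.
    apply: contra (nz i j); rewrite !subr_eq0 => /eqP ->.
    by rewrite mulVf.
  apply: (mulIf P0); apply: (mulIf D0); rewrite [RHS]mulrAC H /f.
  have -> : \matrix_(i < k, j < k)
     (\sum_(0 <= l < N) lag_coef q (E N) N l * (x 0 i * qc ^+ j) ^+ E N l) =
    \matrix_(i < k, j < k) lagP qc (fun j : 'I_N => E N (N - j.+1)%N) (x 0 i * qc ^+ j).
    by apply/matrixP => i j; rewrite !mxE lagP_rev.
  have <- : (\prod_i \prod_(0 <= j < N - k) ratio_factor x i j) *
     (\prod_(i < k) \prod_(j < N - k) (x 0 i - qc ^- (k + j))) =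
     \prod_(i < k) \prod_(j < N - k) (qc ^- i - qc ^- (k + j)).
    rewrite -big_split; apply: eq_bigr => i _ /=.
    rewrite big_mkord -big_split; apply: eq_bigr => j _ /=.
    rewrite /ratio_factor; field.
    by rewrite nz !qn0.
  by field.
apply: ucvM; last first.
  apply: (@ucv_det _ _ _ k
    (fun N (x : 'rV[C]_k) => \matrix_(i < k, j < k)
      \sum_(0 <= l < N) lag_coef q (E N) N l * (x 0 i * qc ^+ j) ^+ E N l)
    (fun x => \matrix_(i < k, j < k) lagP_lim q e (x 0 i * qc ^+ j))) => i j.
  have [U _] := lagP_ucv q0 q1 ge gE cE r1.
  have H x : good_set r d x -> [set y | cmod y <= r] (x 0 i * qc ^+ j).
    move=> [xr _ _] /=; rewrite cmodM cmod_qcX -[r]mulr1.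
    by rewrite ler_pM ?cmod_ge0 ?exprn_ge0 ?exprn_ile1 ?(ltW q0) ?(ltW q1).
  apply: (ucv_ext _ (ucv_near _ (ucv_comp H U))).
    by move=> x _; rewrite mxE.
  by near=> N => x _; rewrite mxE.
apply: ucvM; last first.
  by apply: ucv_prod => i; exact: (ucv_subn k (ucv_ratio_factor i r0 d0)).
apply: ucv_cst; apply: ubdM; first exact: ubd_cst.
exists d^-1 => x [_ xD _]; rewrite cmodV lef_pV2 ?posrE// (lt_le_trans d0)//.
Unshelve. all: by end_near. Qed.

Definition polydisc (r : R) : set 'rV[C]_k := [set x : 'rV[C]_k | forall i, cmod (x 0 i) <= r].

Lemma polyfun_bounded (f : 'rV[C]_k -> C) r : polyfun f -> ubd (polydisc r) f.
Proof.
elim=> [c|i|f1 f2 _ [B1 H1] _ [B2 H2]|f1 f2 _ b1 _ b2]; first exact: ubd_cst.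
- by exists r => x; apply.
- by exists (B1 + B2) => x xr; rewrite (le_trans (cmodD _ _))// lerD ?H1 ?H2.
- exact: ubdM.
Qed.

(* Radii strictly between two consecutive powers of [q^-1], so that on the torus
   [|x_i| = rho i] all denominators of the determinantal formula are bounded
   away from 0. *)
Lemma good_torus r : exists rho : 'I_k -> R, (forall i, r < rho i) /\
  exists r' d, [/\ 1 <= r', 0 < d & forall x : 'rV[C]_k,
    (forall i, cmod (x 0 i) = rho i) -> good_set r' d x].
Proof.
have qn0 n : 0 < q ^+ n by rewrite exprn_gt0.
have [J HJ] : exists J, r * q ^+ J <= q.
  have /cvgrPdist_le/(_ _ q0)[J _ /(_ J (leqnn J))] := cvg_geo0 q0 q1 r.
  by rewrite /= sub0r normrN => /(le_trans (ler_norm _)); exists J.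
(* The relative gap between q^-J and q^-(J+1) is cut into k + 1 equal parts, and the k radii are the
   interior division points. *)
pose h : R := (q^-1 - 1) / k.+1%:R.
have h0 : 0 < h by rewrite divr_gt0 ?ltr0n// subr_gt0 invf_gt1.
pose rho (i : 'I_k) : R := q ^- J * (1 + i.+1%:R * h).
have rho1 i : q ^- J * (1 + h) <= rho i.
  by rewrite ler_pM2l ?invr_gt0// lerD2l ler_peMl ?(ltW h0)// ler1n.
have rho2 i : rho i <= q ^- J * (1 + k%:R * h).
  by rewrite ler_pM2l ?invr_gt0// lerD2l ler_pM2r// ler_nat.
have rho0 i : 0 < rho i.
  by apply: lt_le_trans (rho1 i); rewrite mulr_gt0 ?invr_gt0// addr_gt0.
exists rho; split=> [i|].
  apply: lt_le_trans (rho1 i); rewrite mulrC ltr_pdivlMr//.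
  by apply: le_lt_trans HJ _; rewrite (lt_trans q1)// ltrDl.
pose d1 : R := \prod_(i < k) \prod_(j < k | (i < j)%N) (q ^- J * h).
have d10 : 0 < d1.
  by apply: prodr_gt0 => i _; apply: prodr_gt0 => j _; rewrite mulr_gt0// invr_gt0.
have d20 : 0 < (1 - q) / k.+1%:R by rewrite divr_gt0 ?ltr0n// subr_gt0.
exists (1 + q ^- J * (1 + k%:R * h)), (Num.min d1 (Num.min h ((1 - q) / k.+1%:R))).
split.
- by rewrite lerDl mulr_ge0 ?invr_ge0 ?(ltW (qn0 _))// addr_ge0// mulr_ge0// ltW.
- by rewrite !lt_min d10 h0 d20.
move=> x xr; split=> [i||i j].
- by rewrite xr (le_trans (rho2 i))// lerDr.
- rewrite ge_min; apply/orP; left.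
  rewrite /Delta cmod_prod; apply: ler_prod => i _; rewrite prodr_ge0/=; last first.
    by move=> j _; rewrite mulr_ge0 ?invr_ge0 ?(ltW (qn0 _)) ?(ltW h0).
  rewrite cmod_prod; apply: ler_prod => j ij.
  rewrite mulr_ge0 ?invr_ge0 ?(ltW (qn0 _)) ?(ltW h0)//= cmodC.
  rewrite (le_trans _ (cmod_lerB _ _))// !xr.
  rewrite /rho -mulrBr ler_pM2l ?invr_gt0// opprD addrACA subrr add0r -mulrBl.
  rewrite ler_peMl ?(ltW h0)// -natrB ?ltnS 1?ltnW//.
  by rewrite ler1n subn_gt0 ltnS.
rewrite ge_min; apply/orP; right; rewrite ge_min.
have [kjJ|Jkj] := leqP (k + j) J.
  apply/orP; left; rewrite cmodC (le_trans _ (cmod_lerB _ _))// cmod1 cmodM cmod_qcX xr.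
  rewrite lerBrDr addrC (@le_trans _ _ (q ^- J * (1 + h) * q ^+ J))//.
    by rewrite mulrAC mulVf ?mul1r// gt_eqF.
  rewrite ler_pM ?exprn_ge0 ?(ltW q0) ?mulr_ge0 ?invr_ge0 ?(ltW (qn0 _)) ?addr_ge0 ?(ltW h0)//.
  exact: qpow_le.
apply/orP; right; rewrite (le_trans _ (cmod_lerB _ _))// cmod1 cmodM cmod_qcX xr.
rewrite lerBrDr addrC -lerBrDr (@le_trans _ _ (q ^- J * (1 + k%:R * h) * q ^+ J.+1))//.
  rewrite ler_pM ?exprn_ge0 ?(ltW q0) ?(ltW (rho0 _))//.
  exact: qpow_le.
rewrite exprS mulrCA mulrAC mulVf ?gt_eqF// mul1r /h.
have -> : 1 - (1 - q) / k.+1%:R = q * (1 + k%:R * ((q^-1 - 1) / k.+1%:R)) => //.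
have kk : k%:R = k.+1%:R - 1 :> R by rewrite -natr1 addrK.
have : k.+1%:R != 0 :> R by rewrite pnatr_eq0.
rewrite kk; move: (k.+1%:R : R) => K Kn0; field.
by rewrite (gt_eqF q0) ?Kn0.
Qed.

Definition Qlim (x : 'rV[C]_k) : C := lim (Q N x @[N --> \oo]).

(** The Cauchy estimate is applied to the polynomial Q_m - Q_n, so nothing has to be known
    beforehand about the limit inside the polydisc: being uniformly Cauchy on the torus propagates
    inwards, and completeness supplies the limit. *)
Lemma Q_ucv r : 0 < r -> ucv (polydisc r) Q Qlim.
Proof.
move=> r0; apply: ucv_cauchy => [N|eps eps0]; first exact: polyfun_bounded.
have [rho [rrho [r' [d [r'1 d0 Hg]]]]] := good_torus r.
have [_ cv] := Q_ucv_good r'1 d0.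
pose K : R := \prod_i (1 - r / rho i)^-1.
have K0 : 0 < K.
  apply: prodr_gt0 => i _; rewrite invr_gt0 subr_gt0 ltr_pdivrMr ?mul1r//.
  exact: lt_trans (rrho i).
have e2 : 0 < eps / K / 2 by rewrite !divr_gt0.
have [N0 _ HN] := cv _ e2; exists N0 => m n mN nN x xr.
rewrite -[eps](@divfK _ K) ?gt_eqF//.
apply: (cauchy_polydisc (f := fun x => Q m x - Q n x) (rho := rho) _ r0) => //.
  exact: polyfunB.
move=> y Hy; apply: (le_trans (cmodB_tri _ (ratio_lim y) _)).
rewrite (splitr (eps / K)) lerD//; first by apply: HN => //; exact: Hg.
by rewrite cmodC; apply: HN => //; exact: Hg.
Qed.

Lemma Qlim_continuous : continuous Qlim.
Proof.
move=> x.
pose r : R := 1 + \sum_i cmod (x 0 i).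
have r0 : 0 < r by rewrite ltr_pwDl// sumr_ge0// => i _; exact: cmod_ge0.
have r1 : 0 < r + 1 by rewrite addr_gt0.
apply: (ucv_continuous (Q_ucv r1)); last by move=> N; exact: polyfun_continuous.
have H : nbhs x [set y : 'rV[C]_k | forall i, cmod (y 0 i - x 0 i) <= 1].
  have Hi (i : 'I_k) : nbhs x [set y : 'rV[C]_k | cmod (y 0 i - x 0 i) <= 1].
    have : (fun y : 'rV[C]_k => y 0 i) y @[y --> x] --> x 0 i by exact: coord_continuous.
    by move=> /cvg_cmodP/(_ _ ltr01).
  exact: (@filter_forall _ _ (fun (i : 'I_k) (y : 'rV[C]_k) => cmod (y 0 i - x 0 i) <= 1) (nbhs x) _ Hi).
apply: filterS H => y Hy i.
rewrite -(subrK (x 0 i) (y 0 i)) (le_trans (cmodD _ _))// addrC lerD//.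
rewrite /r (bigD1 i)//= addrCA lerDl addr_ge0// sumr_ge0// => j _; exact: cmod_ge0.
Qed.

Lemma Qlim_good r d x : 1 <= r -> 0 < d -> good_set r d x -> Qlim x = ratio_lim x.
Proof.
move=> r1 d0 gx; apply: cvg_lim; first exact: norm_hausdorff.
exact: ucv_cvg (Q_ucv_good r1 d0) gx.
Qed.

End QLimit.

(** * The function F_nu *)

Section NuExponents.
Variable nu : nat -> int.
Hypothesis nu_le : forall j, nu j <= nu j.+1.

Definition nu_exp (j : nat) : nat := absz (nu j + j%:Z - nu 0)%R.

Lemma nu_mono i j : (i <= j)%N -> nu i <= nu j.
Proof. by move=> /subnK <-; elim: (j - i)%N => // n IH; apply: le_trans IH _; rewrite addSn. Qed.

Lemma nu_expE j : (nu_exp j)%:Z = nu j + j%:Z - nu 0.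
Proof. by rewrite /nu_exp gez0_abs// subr_ge0 ler_wpDr// nu_mono. Qed.

Lemma gapped_nu_exp N : gapped nu_exp N.
Proof.
move=> i j ij _; have := nu_mono ij.
by rewrite -lez_nat PoszD !nu_expE -subzn//; lia.
Qed.

End NuExponents.

Section Fnu.
Variables (R : realType) (q : R).
Hypotheses (q0 : 0 < q) (q1 : q < 1).
Local Notation C := (cplx R).
Let qc : C := real_complex R q.

Lemma qPoch_ucv (r : R) : 0 <= r ->
  ucv [set a | cmod a <= r] (fun N a => \prod_(0 <= i < N) (1 - a * qc ^+ i)) (qPoch qc).
Proof.
move=> r0; apply: (@ucv_infprod R q q0 q1 C _ (fun i a => - (a * qc ^+ i)) r r0).
move=> j a /= ar; rewrite cmodN cmodM cmod_qcX//.
by rewrite ler_wpM2r ?exprn_ge0 ?(ltW q0).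
Qed.

Lemma qPoch_cvg (a : C) :
  \prod_(0 <= i < N) (1 - a * qc ^+ i) @[N --> \oo] --> qPoch qc a.
Proof. by apply: (ucv_cvg (qPoch_ucv (cmod_ge0 a))) => /=. Qed.

(** Past the index where |a| q^J <= 1/2 every factor has modulus at least 1/2, so only a finite
    minimum is at stake. *)
Lemma qPoch_bounded_below (a : C) : (forall j : nat, 1 - a * qc ^+ j != 0) ->
  exists2 d : R, 0 < d & forall j : nat, d <= cmod (1 - a * qc ^+ j).
Proof.
move=> H.
have [J HJ] : exists J, cmod a * q ^+ J <= 2^-1.
  have h : 0 < 2^-1 :> R by rewrite invr_gt0.
  have /cvgrPdist_le/(_ _ h)[J _ /(_ J (leqnn J))] := cvg_geo0 q0 q1 (cmod a).
  by rewrite /= sub0r normrN => /(le_trans (ler_norm _)); exists J.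
have [d d0 Hd] : exists2 d : R, 0 < d & forall j, (j < J)%N -> d <= cmod (1 - a * qc ^+ j).
  elim: J {HJ} => [|J [d d0 Hd]]; first by exists 1.
  exists (Num.min d (cmod (1 - a * qc ^+ J))); first by rewrite lt_min d0 cmod_gt0 H.
  move=> j; rewrite ltnS leq_eqVlt ge_min => /orP[/eqP ->|/Hd ->//].
  by rewrite lexx orbT.
exists (Num.min d 2^-1); first by rewrite lt_min d0 invr_gt0 ltr0n.
move=> j; rewrite ge_min; have [/Hd ->//|Jj] := ltnP j J.
apply/orP; right; rewrite (le_trans _ (cmod_lerB _ _))// cmod1 cmodM cmod_qcX//.
rewrite lerBrDr addrC -lerBrDr (_ : 1 - 2^-1 = 2^-1); last by field.
by apply: le_trans HJ; rewrite ler_wpM2l ?cmod_ge0//; exact: qpow_le.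
Qed.

Lemma qPoch_neq0P (a : C) : qPoch qc a != 0 <-> forall j : nat, 1 - a * qc ^+ j != 0.
Proof.
split=> [H j|H].
  apply: contra H => /eqP aj; apply/eqP.
  apply: cvg_lim; first exact: norm_hausdorff.
  apply: cvg_near_cst; near=> n.
  have jn : (j < n)%N by near: n; exact: nbhs_infty_gt.
  by rewrite big_mkord (bigD1 (Ordinal jn))//= aj mul0r.
have [d d0 Hd] := qPoch_bounded_below H.
have Hw j : cmod (- (a * qc ^+ j)) <= cmod a * q ^+ j.
  by rewrite cmodN cmodM cmod_qcX.
have := infprod_inv q0 q1 (cmod_ge0 a) d0 Hw Hd; rewrite -/(qPoch qc a) => E.
apply/eqP => z; have := E; rewrite z mulr0 => /esym/eqP.
by rewrite oner_eq0.
Unshelve. all: by end_near. Qed.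

Lemma cmod_near (y : C) : nbhs y [set x : C | cmod x <= cmod y + 1].
Proof.
apply: filterS (nbhs_cmod y ltr01) => x /= H.
by rewrite -(subrK y x) (le_trans (cmodD _ _))// addrC lerD2l.
Qed.

Lemma qPoch_continuous : continuous (qPoch qc).
Proof.
move=> y; have r0 : 0 <= cmod y + 1 by rewrite addr_ge0 ?cmod_ge0.
apply: (ucv_continuous (qPoch_ucv r0) (cmod_near y)) => N.
apply: continuous_prod => i.
apply: continuousB; first exact: cst_continuous.
apply: continuousM; [exact: cvg_id|exact: cst_continuous].
Qed.

Variable nu : nat -> int.
Hypothesis nu_le : forall j, nu j <= nu j.+1.
Local Notation P := (lagP_lim q (nu_exp nu)).

(** Allows the results on varying exponents to be used for the constant family [nu_exp nu]. *)
Let cst_near (j : nat) : \forall N \near \oo, (fun _ : nat => nu_exp nu) N j = nu_exp nu j.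
Proof. by near=> N. Unshelve. all: by end_near. Qed.

Lemma lagP_lim_cvg (x : C) :
  \sum_(0 <= k < N) lag_coef q (nu_exp nu) N k * x ^+ nu_exp nu k @[N --> \oo] --> P x.
Proof.
have r1 : 1 <= 1 + cmod x by rewrite lerDl cmod_ge0.
have [U _] := lagP_ucv q0 q1 (gapped_nu_exp nu_le) (fun N => @gapped_nu_exp nu nu_le N) cst_near r1.
by apply: (ucv_cvg U) => /=; rewrite lerDr.
Qed.

Lemma lagP_lim_series (x : C) :
  \sum_(0 <= k < N) lag_lim q (nu_exp nu) k * x ^+ nu_exp nu k @[N --> \oo] --> P x.
Proof.
have r1 : 1 <= 1 + cmod x by rewrite lerDl cmod_ge0.
have [_ U] := lagP_ucv q0 q1 (gapped_nu_exp nu_le) (fun N => @gapped_nu_exp nu nu_le N) cst_near r1.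
by apply: (ucv_cvg U) => /=; rewrite lerDr.
Qed.

Lemma lagP_lim_continuous : continuous P.
Proof.
move=> y; have r1 : 1 <= cmod y + 1 by rewrite lerDr cmod_ge0.
have [_ U] := lagP_ucv q0 q1 (gapped_nu_exp nu_le) (fun N => @gapped_nu_exp nu nu_le N) cst_near r1.
apply: (ucv_continuous U (cmod_near y)) => N.
apply: continuous_sum => k.
have cX : {for y, continuous (fun x : C => x ^+ nu_exp nu k)}.
  by apply: (@continuous_exprn R C id); exact: cvg_id.
apply: (@continuousM C C (fun=> lag_lim q (nu_exp nu) k) (fun x => x ^+ nu_exp nu k)).
  exact: cst_continuous.
exact: cX.
Qed.

Lemma gapped_inj (F : nat -> nat) N : gapped F N ->
  injective (fun j : 'I_N => qc ^+ F (N - j.+1)%N).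
Proof.
move=> gF i j /(qc_inj q0 q1) h.
apply: rev_ord_inj; apply: val_inj => /=.
have := ltn_ord i; have := ltn_ord j => jN iN.
have := @gF (N - i.+1)%N (N - j.+1)%N; have := @gF (N - j.+1)%N (N - i.+1)%N; lia.
Qed.

(** The partial sums with [lag_coef], unlike those with [lag_lim], are exact interpolation sums,
    equal to the right-hand side as soon as N > s. The zeros obtained for s >= 1 cancel the poles of
    the prefactor of F_nu. *)
Lemma lagP_lim_qV s : P (qc ^- s) = (s == 0%N)%:R.
Proof.
apply: (cvg_unique (@norm_hausdorff _ _) (@lagP_lim_cvg (qc ^- s))).
apply: cvg_near_cst; near=> N.
rewrite -lagP_rev lagP_qV//; first by rewrite qc_neq0.
  exact/gapped_inj/gapped_nu_exp.
by near: N; exact: nbhs_infty_gt.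
Unshelve. all: by end_near. Qed.

Lemma Fnu_series (x : C) : x != 0 ->
  \big[+%R/0]_(0 <= k <oo)
        (x ^ (nu k + k%:Z) /
         \big[*%R/1]_(0 <= j <oo | j != k)
           (1 - qc ^ (- nu k - k%:Z) * qc ^ (nu j + j%:Z))) = x ^ nu 0 * P x.
Proof.
move=> x0; apply: cvg_lim; first exact: norm_hausdorff.
have qn0 : qc != 0 by rewrite qc_neq0.
have -> : (fun n => \sum_(0 <= k < n) (x ^ (nu k + k%:Z) /
         \big[*%R/1]_(0 <= j <oo | j != k)
           (1 - qc ^ (- nu k - k%:Z) * qc ^ (nu j + j%:Z)))) =
  (fun n => x ^ nu 0 * \sum_(0 <= k < n) lag_lim q (nu_exp nu) k * x ^+ nu_exp nu k).
  apply/funext => n; rewrite mulr_sumr; apply: eq_bigr => k _.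
  have E j : nu j + j%:Z = nu 0 + (nu_exp nu j)%:Z by rewrite (nu_expE nu_le); ring.
  have -> : \big[*%R/1]_(0 <= j <oo | j != k)
           (1 - qc ^ (- nu k - k%:Z) * qc ^ (nu j + j%:Z)) =
     \big[*%R/1]_(0 <= j <oo | j != k) (1 - qc ^+ nu_exp nu j / qc ^+ nu_exp nu k).
    have -> // : (fun n => \prod_(0 <= j < n | j != k)
           (1 - qc ^ (- nu k - k%:Z) * qc ^ (nu j + j%:Z))) =
     (fun n => \prod_(0 <= j < n | j != k) (1 - qc ^+ nu_exp nu j / qc ^+ nu_exp nu k)).
    apply/funext => m; apply: eq_bigr => j _; congr (1 - _).
    rewrite -opprD !E -expfzDr// [qc ^+ _ / _](_ : _ = qc ^ ((nu_exp nu j)%:Z - (nu_exp nu k)%:Z)).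
      by congr (qc ^ _); ring.
    by rewrite expfzDr// exprnN.
  have := lag_lim_inv q0 q1 (gapped_nu_exp nu_le) k; set D := limn _ => HD.
  have D0 : D != 0 by apply/eqP => z; move: HD; rewrite z mul0r => /esym/eqP; rewrite oner_eq0.
  rewrite E expfzDr//; have -> : lag_lim q (nu_exp nu) k = D^-1.
    by apply: (mulfI D0); rewrite HD mulfV.
  by rewrite -mulrA; congr (_ * _); rewrite mulrC.
by apply: cvgM; [exact: cvg_cst|exact: lagP_lim_series].
Qed.

(* At the zeros [q ^- j.+1] of the q-Pochhammer symbol both sides vanish. *)
Lemma Fnu_qPoch (y : C) : y != 0 ->
  Fnu qc nu y * qPoch qc (y * qc) = qPoch qc qc * (y ^ nu 0 * P y).
Proof.
move=> y0.
have [/qPoch_neq0P H|] := boolP (qPoch qc (y * qc) != 0); last first.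
  rewrite negbK => /eqP z; rewrite z mulr0.
  have [j /eqP] : exists j : nat, 1 - y * qc * qc ^+ j == 0.
    apply: contrapT => nex.
    have /qPoch_neq0P : forall j : nat, 1 - y * qc * qc ^+ j != 0.
      by move=> j; apply/negP => h; apply: nex; exists j.
    by rewrite z eqxx.
  rewrite -mulrA -exprS => /eqP; rewrite subr_eq0 => /eqP h.
  have -> : y = qc ^- j.+1.
    by rewrite -[RHS]mul1r h mulfK// expf_neq0// qc_neq0.
  by rewrite lagP_lim_qV !mulr0.
have Hy : qPoch qc (y * qc) != 0 by apply/qPoch_neq0P.
suff -> : Fnu qc nu y = qPoch qc qc / qPoch qc (y * qc) * (y ^ nu 0 * P y).
  by rewrite mulrAC divfK.
rewrite /Fnu; apply: (cont_ext_eq (g := fun y : C =>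
   qPoch qc qc / qPoch qc (y * qc) * (y ^ nu 0 * P y))).
- move=> x [x0 Hx]; rewrite (Fnu_series x0); congr (_ * _).
  have Hx' : qPoch qc (x * qc) != 0.
    by apply/qPoch_neq0P => j; rewrite -mulrA -exprS mulrC.
  apply: cvg_lim; first exact: norm_hausdorff.
  have -> : (fun n => \prod_(0 <= j < n) ((1 - qc ^+ j.+1) / (1 - qc ^+ j.+1 * x))) =
     (fun n => (\prod_(0 <= i < n) (1 - qc * qc ^+ i)) * (\prod_(0 <= i < n) (1 - x * qc * qc ^+ i))^-1).
    apply/funext => n; rewrite -prodfV -big_split; apply: eq_bigr => j _ /=.
    by rewrite -exprS (_ : x * qc * qc ^+ j = qc ^+ j.+1 * x)// exprS; ring.
  by apply: cvgM; [exact: qPoch_cvg|apply: cvgV => //; exact: qPoch_cvg].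
- apply: continuousM.
    apply: continuousM; first exact: cst_continuous.
    have cm : {for y, continuous (fun z : C => z * qc)}.
      by apply: continuousM; [exact: cvg_id|exact: cst_continuous].
    have cq : {for y, continuous (qPoch qc \o (fun z : C => z * qc))}.
      by apply: continuous_comp; [exact: cm|exact: qPoch_continuous].
    exact: (continuousV (s := qPoch qc \o (fun z : C => z * qc)) Hy cq).
  apply: continuousM; last exact: lagP_lim_continuous.
  by apply: (@continuous_exprz _ _ id); [exact: y0|exact: cvg_id].
- apply: subset_closure; split=> // j.
  by have := H j; rewrite -mulrA -exprS mulrC.
Qed.

End Fnu.

(** * The determinant of q-difference operators *)

Section QDifference.
Variable C : numClosedFieldType.

Definition qdiff1 (p : C) (h : C -> C) : C -> C := fun t => (h (p * t) - h t) / (p - 1).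

Lemma qdiff_prod k (p : C) (i : 'I_k) (h : 'I_k -> C -> C) :
  qdiff p i (fun y : 'rV[C]_k => \prod_l h l (y 0 l)) =
  (fun y => \prod_l (if l == i then qdiff1 p (h l) else h l) (y 0 l)).
Proof.
apply/funext => y; rewrite /qdiff (bigD1 i)//= [X in _ - X](bigD1 i)//= [RHS](bigD1 i)//= !mxE eqxx.
under eq_bigr => l li do rewrite mxE (negPf li).
under [in RHS]eq_bigr => l li do rewrite (negPf li).
by rewrite -mulrBl mulrAC.
Qed.

Lemma iter_qdiff_prod k (p : C) (i : 'I_k) m (h : 'I_k -> C -> C) :
  iter m (qdiff p i) (fun y : 'rV[C]_k => \prod_l h l (y 0 l)) =
  (fun y => \prod_l (if l == i then iter m (qdiff1 p) (h l) else h l) (y 0 l)).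
Proof.
elim: m => [|m IH] /=.
  by apply/funext => y; apply: eq_bigr => l _; case: ifP.
rewrite IH (qdiff_prod p i (fun l => if l == i then iter m (qdiff1 p) (h l) else h l)); apply/funext => y; apply: eq_bigr => l _.
by case: (l == i).
Qed.

(** On a product of functions of one variable each, the i-th operator touches only the i-th factor,
    so every Leibniz term splits and an ordinary determinant results. *)
Lemma det_qdiffE k (p : C) (h : C -> C) (x : 'rV[C]_k) :
  det_qdiff p (fun y => \prod_(i < k) h (y 0 i)) x =
  \det (\matrix_(i < k, j < k) iter j (qdiff1 p) h (x 0 i)).
Proof.
rewrite /det_qdiff /determinant; apply: eq_bigr => s _; congr (_ * _).
have K (r : seq 'I_k) : uniq r ->
    foldr (fun i g => iter (s i) (qdiff p i) g) (fun y : 'rV[C]_k => \prod_l h (y 0 l)) r =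
    (fun y => \prod_l (if l \in r then iter (s l) (qdiff1 p) h else h) (y 0 l)).
  elim: r => [|i r IH] /=; first by [].
  move=> /andP[ir ur]; rewrite (IH ur)
    (iter_qdiff_prod p i (s i) (fun l => if l \in r then iter (s l) (qdiff1 p) h else h)).
  apply/funext => y; apply: eq_bigr => l _; rewrite inE.
  by case: eqP => [->|//]; rewrite (negPf ir).
rewrite (K _ (enum_uniq 'I_k)); apply: eq_bigr => l _.
by rewrite mem_enum !mxE.
Qed.

(** Coefficient of T^m in ((T - 1)/(p - 1))^j, where T is the dilation t -> pt; the recursion is
    multiplication by one more factor. *)
Fixpoint qdiff_coef (p : C) (j m : nat) : C :=
  match j, m with
  | 0, 0 => 1
  | 0, _.+1 => 0
  | j'.+1, 0 => - qdiff_coef p j' 0 / (p - 1)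
  | j'.+1, m'.+1 => (qdiff_coef p j' m' - qdiff_coef p j' m'.+1) / (p - 1)
  end.

Lemma qdiff_coef_gt p j m : (j < m)%N -> qdiff_coef p j m = 0.
Proof.
elim: j m => [|j IH] [|m]//= jm; by rewrite !IH ?subrr ?mul0r// ltnW.
Qed.

Lemma qdiff_coef_diag p j : qdiff_coef p j j = (p - 1) ^- j.
Proof.
elim: j => [|j IH] /=; first by rewrite expr0 invr1.
by rewrite IH qdiff_coef_gt// subr0 exprSr invfM.
Qed.

Lemma iter_qdiff1 p h t j n : (j < n)%N ->
  iter j (qdiff1 p) h t = \sum_(m < n) qdiff_coef p j m * h (p ^+ m * t).
Proof.
elim: j n t => [|j IH] [|n]// t jn.
  rewrite big_ord_recl/= mul1r expr0 mul1r big1 ?addr0// => i _.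
  by rewrite mul0r.
rewrite iterS {1}/qdiff1 (IH n)// (IH n.+1 t) ?(ltnW jn)// [in RHS]big_ord_recl/=.
rewrite big_ord_recl/=.
under eq_bigr => i _ do rewrite mulrA -exprSr -[i.+1]add1n.
under [in RHS]eq_bigr => i _ do rewrite mulrAC mulrBl.
by rewrite -mulr_suml sumrB; ring.
Qed.

(** Iterated differences are obtained from dilates by a triangular change of columns with diagonal
    (p-1)^-j; the exponents 0 + 1 + ... + (k-1) add up to binom(k,2). *)
Lemma det_iter_qdiff1 k (p : C) (h : C -> C) (x : 'rV[C]_k) :
  \det (\matrix_(i < k, j < k) iter j (qdiff1 p) h (x 0 i)) =
  \det (\matrix_(i < k, m < k) h (p ^+ m * x 0 i)) / (p - 1) ^+ 'C(k, 2).
Proof.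
have -> : (p - 1) ^- 'C(k, 2) = \det (\matrix_(m < k, j < k) qdiff_coef p j m).
  rewrite -det_tr det_trig; last first.
    by apply/is_trig_mxP => i j ij; rewrite !mxE qdiff_coef_gt.
  rewrite -bin2_sum (big_morph (fun n => (p - 1) ^- n) (id1 := 1) (op1 := *%R)); last 2 first.
  - by move=> a b; rewrite exprD invfM.
  - by rewrite expr0 invr1.
  by rewrite big_mkord; apply: eq_bigr => i _; rewrite !mxE qdiff_coef_diag.
rewrite -det_mulmx; congr (\det _); apply/matrixP => i j; rewrite !mxE.
by rewrite (iter_qdiff1 _ _ _ (ltn_ord j)); apply: eq_bigr => m _; rewrite !mxE mulrC.
Qed.

Definition rev_perm k : 'S_k := perm (@rev_ord_inj k).

Lemma rev_permS k : rev_perm k.+1 = lift_perm ord0 ord_max (rev_perm k).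
Proof.
apply/permP => i; rewrite permE; have [j ->|->] := unliftP ord0 i.
  rewrite lift_perm_lift permE; apply: val_inj => /=.
  have jk := ltn_ord j; rewrite /bump leq0n add1n subSS.
  by have -> : (k <= k - j.+1)%N = false by lia.
by rewrite lift_perm_id; apply: val_inj => /=; rewrite subn1.
Qed.

Lemma odd_rev_perm k : odd_perm (rev_perm k) = odd 'C(k, 2).
Proof.
elim: k => [|k IH].
  by rewrite (_ : rev_perm 0 = 1%g) ?odd_perm1//; apply/permP => -[].
by rewrite rev_permS odd_lift_perm IH binS bin1 oddD addbC.
Qed.

(** Dilations by 1/q starting from x_i q^(k-1) run through x_i q^(k-1-m), the opposite column order
    to the finite-N determinant. Reversal of k columns has sign (-1)^binom(k,2). *)
Lemma det_rev k (f : 'I_k -> 'I_k -> C) :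
  \det (\matrix_(i, j) f i (rev_ord j)) = (-1) ^+ 'C(k, 2) * \det (\matrix_(i, j) f i j).
Proof.
rewrite -signr_odd -odd_rev_perm -det_perm mulrC -det_mulmx.
congr (\det _); apply/matrixP => i j; rewrite !mxE (bigD1 (rev_ord j))//= !mxE.
rewrite permE rev_ordK eqxx mulr1 big1 ?addr0// => l lj; rewrite !mxE permE.
by rewrite (inv_eq rev_ordK) (negPf lj) mulr0.
Qed.

Lemma det_scale k (a b : 'I_k -> C) (f : 'I_k -> 'I_k -> C) :
  \det (\matrix_(i, j) (a i * b j * f i j)) =
  (\prod_i a i) * (\prod_j b j) * \det (\matrix_(i, j) f i j).
Proof.
have <- : \det (diag_mx (\row_i a i)) = \prod_i a i.
  by rewrite det_diag; apply: eq_bigr => i _; rewrite mxE.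
have <- : \det (diag_mx (\row_i b i)) = \prod_i b i.
  by rewrite det_diag; apply: eq_bigr => i _; rewrite mxE.
rewrite mulrAC -!det_mulmx mul_diag_mx mul_mx_diag; congr (\det _).
by apply/matrixP => i j; rewrite !mxE mulrAC.
Qed.

(** The factor -q^-j occurs j times, and the sum of j^2 over j < k equals binom(k,2) + 2 binom(k,3).
    This is the origin of binom(k,3) in the constant. *)
Lemma prod_node_exponents (q : C) k : q != 0 ->
  \prod_(i < k) \prod_(j < k | (i < j)%N) (- q ^- j) =
  (-1) ^+ 'C(k, 2) * q ^- ('C(k, 2) + 2 * 'C(k, 3)).
Proof.
move=> q0.
have -> : \prod_(i < k) \prod_(j < k | (i < j)%N) (- q ^- j) = \prod_(0 <= j < k) (- q ^- j) ^+ j.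
  rewrite (exchange_big_dep xpredT)//= big_mkord; apply: eq_bigr => j _.
  by rewrite -(big_ord_widen k (fun=> - q ^- j) (ltnW (ltn_ord j))) prodr_const card_ord.
elim: k => [|k IH]; first by rewrite big_nil bin0n expr0 mul1r muln0 expr0 invr1.
have kk : (k * k = k + 2 * 'C(k, 2))%N.
  by elim: k {IH} => // k; rewrite binS bin1; lia.
rewrite big_nat_recr//= IH !binS bin1 -[- q ^- k]mulN1r exprMn exprVn -exprM kk.
rewrite mulrACA -exprD -invfM -exprD; congr (_ * _ ^-1); congr (_ ^+ _); lia.
Qed.

End QDifference.

(** * The function F_nu^(k) *)

Section Fnuk.
Variables (R : realType) (q : R).
Hypotheses (q0 : 0 < q) (q1 : q < 1).
Local Notation C := (cplx R).
Let qc : C := real_complex R q.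

Lemma qPoch_split n (a : C) :
  qPoch qc a = (\prod_(0 <= j < n) (1 - a * qc ^+ j)) * qPoch qc (a * qc ^+ n).
Proof.
have c1 := @qPoch_cvg R q q0 q1 a; rewrite -(cvg_shiftn n) in c1.
apply: (cvg_unique (@norm_hausdorff _ _) c1).
have -> : (fun N => \prod_(0 <= i < N + n) (1 - a * qc ^+ i)) =
   (fun N => (\prod_(0 <= j < n) (1 - a * qc ^+ j)) * \prod_(0 <= i < N) (1 - a * qc ^+ n * qc ^+ i)).
  apply/funext => N; rewrite (@big_cat_nat _ _ _ n 0 (N + n))//= ?leq_addl//; congr (_ * _).
  rewrite -{1}[n]add0n big_addn addnK; apply: eq_bigr => i _.
  by rewrite addnC exprD mulrA.
by apply: cvgM; [exact: cvg_cst|exact: qPoch_cvg].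
Qed.

Let qn0 n : qc ^+ n != 0. Proof. by rewrite expf_neq0// qc_neq0. Qed.

(** The Vandermonde factor q^-i - q^-j is -q^-j (1 - q^(j-i)). For fixed i the factors 1 - q^(j-i)
    are exactly those that complete (q^(k-i);q)_oo to (q;q)_oo, whence the k-th power. *)
Lemma node_const k :
  qc ^- 'C(k, 2) * qc ^- (2 * 'C(k, 3)) * (-1) ^+ 'C(k, 2) * qPoch qc qc ^+ k =
  Delta (\row_(i < k) qc ^- i) * \prod_(i < k) qPoch qc (qc ^+ (k - i)).
Proof.
rewrite -invfM -exprD mulrC [_ ^-1 * _]mulrC -prod_node_exponents ?qc_neq0//.
rewrite -[X in _ ^+ X]card_ord -prodr_const -!big_split; apply: eq_bigr => i _ /=.
rewrite (qPoch_split (k - i.+1) qc) -exprS subnSK// mulrAC; congr (_ * _).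
under [RHS]eq_bigr => j ij.
  have -> : (\row_(i0 < k) qc ^- i0) 0 i - (\row_(i0 < k) qc ^- i0) 0 j =
      - qc ^- j * (1 - qc ^+ (j - i)).
    have -> : qc ^+ (j - i) = qc ^+ j / qc ^+ i.
      by rewrite -[in RHS](subnK (ltnW ij)) exprD mulfK.
    by rewrite !mxE; field; rewrite !qn0.
  over.
rewrite big_split/= mulrC; congr (_ * _).
have -> : \prod_(j < k | (i < j)%N) (1 - qc ^+ (j - i)) =
    \prod_(i.+1 <= j < k) (1 - qc ^+ (j - i)) by rewrite big_geq_mkord.
rewrite -{2}[i.+1]add0n big_addn; apply: eq_bigr => j _.
by rewrite addnS subSn ?leq_addl// addnK exprS.
Qed.

Lemma ratio_factor_prod k (x : 'rV[C]_k) (i : 'I_k) : qPoch qc (x 0 i * qc ^+ k) != 0 ->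
  \big[*%R/1]_(0 <= j <oo) ratio_factor q x i j =
  qPoch qc (qc ^+ (k - i)) / qPoch qc (x 0 i * qc ^+ k).
Proof.
move=> nz; apply: cvg_lim; first exact: norm_hausdorff.
have -> : (fun n => \prod_(0 <= j < n) ratio_factor q x i j) =
   (fun n => (\prod_(0 <= j < n) (1 - qc ^+ (k - i) * qc ^+ j)) *
             (\prod_(0 <= j < n) (1 - x 0 i * qc ^+ k * qc ^+ j))^-1).
  apply/funext => n; rewrite -prodfV -big_split; apply: eq_bigr => j _ /=.
  rewrite /ratio_factor -mulrA -!exprD; congr ((1 - _) / _).
  have -> : (k + j = (k - i + j) + i)%N by have := ltn_ord i; lia.
  by rewrite exprD mulfK.
have c2 := @qPoch_cvg R q q0 q1 (x 0 i * qc ^+ k).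
by apply: cvgM; [exact: qPoch_cvg|exact: (cvgV nz c2)].
Qed.

Variables (nu : nat -> int) (k : nat).
Hypothesis nu_le : forall j, nu j <= nu j.+1.
Hypothesis k0 : (0 < k)%N.
Local Notation P := (lagP_lim q (nu_exp nu)).

Definition Fnuk_dom : set 'rV[C]_k :=
  [set x | distinct_nonzero x /\ forall i, qPoch qc (x 0 i * qc ^+ k) != 0].

(** Once the operators are eliminated, the entries are values of F_nu(y) (yq;q)_oo at y = x_i
    q^(k-1-m), to which [Fnu_qPoch] applies. The power of q^-1 - 1 in the constant cancels the
    triangular change of columns; the other constants are matched by [node_const]. *)
Lemma Fnuk_formula (x : 'rV[C]_k) : Fnuk_dom x ->
  (qc^-1 * (qc^-1 - 1)) ^+ 'C(k, 2) * qc ^- (2 * 'C(k, 3)) /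
      (Delta x * \prod_(i < k) qPoch qc (x 0 i * qc ^+ k)) *
      det_qdiff qc^-1
        (fun y => \prod_(i < k)
           (Fnu qc nu (y 0 i * qc ^+ k.-1) * qPoch qc (y 0 i * qc ^+ k))) x =
  (\prod_(i < k) (x 0 i * qc ^+ i) ^ nu 0) * ratio_lim q (nu_exp nu) x.
Proof.
move=> [xD xP]; have [x0 _] := xD; have D0 := Delta_neq0 xD.
rewrite (det_qdiffE qc^-1 (fun t => Fnu qc nu (t * qc ^+ k.-1) * qPoch qc (t * qc ^+ k))).
rewrite det_iter_qdiff1.
pose g (t : C) := t ^ nu 0 * P t.
have -> : \det (\matrix_(i < k, m < k)
    (Fnu qc nu (qc^-1 ^+ m * x 0 i * qc ^+ k.-1) * qPoch qc (qc^-1 ^+ m * x 0 i * qc ^+ k))) =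
  qPoch qc qc ^+ k * ((-1) ^+ 'C(k, 2) * \det (\matrix_(i, m) g (x 0 i * qc ^+ m))).
  rewrite -(det_rev (fun i m : 'I_k => g (x 0 i * qc ^+ m))) -detZ; congr (\det _).
  apply/matrixP => i m; rewrite !mxE.
  have E : qc^-1 ^+ m * x 0 i * qc ^+ k.-1 = x 0 i * qc ^+ (k - m.+1).
    have -> : (k.-1 = k - m.+1 + m)%N by have := ltn_ord m; lia.
    by rewrite exprD exprVn; field; rewrite qn0.
  have -> : qc^-1 ^+ m * x 0 i * qc ^+ k = x 0 i * qc ^+ (k - m.+1) * qc.
    by rewrite -E -[RHS]mulrA -exprSr prednK.
  by rewrite E (Fnu_qPoch q0 q1 nu_le)// mulf_neq0.
have -> : \det (\matrix_(i < k, m < k) g (x 0 i * qc ^+ m)) =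
    (\prod_(i < k) (x 0 i * qc ^+ i) ^ nu 0) *
    \det (\matrix_(i < k, j < k) P (x 0 i * qc ^+ j)).
  have -> : \prod_(i < k) (x 0 i * qc ^+ i) ^ nu 0 =
      (\prod_(i < k) x 0 i ^ nu 0) * \prod_(i < k) (qc ^+ i) ^ nu 0.
    by rewrite -big_split; apply: eq_bigr => i _ /=; rewrite expfzMl.
  rewrite -(det_scale (fun i => x 0 i ^ nu 0) (fun j : 'I_k => (qc ^+ j) ^ nu 0)
    (fun i j => P (x 0 i * qc ^+ j))).
  by congr (\det _); apply/matrixP => i j; rewrite !mxE /g expfzMl.
rewrite /ratio_lim.
have -> : \prod_i \big[*%R/1]_(0 <= j <oo) ratio_factor q x i j =
    (\prod_(i < k) qPoch qc (qc ^+ (k - i))) / \prod_(i < k) qPoch qc (x 0 i * qc ^+ k).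
  by rewrite -prodfV -big_split; apply: eq_bigr => i _ /=; rewrite ratio_factor_prod.
have := node_const k; rewrite -/qc.
have : \prod_(i < k) qPoch qc (x 0 i * qc ^+ k) != 0 by apply/prodf_neq0 => i _.
have q10 : qc^-1 - 1 != 0.
  rewrite subr_eq0; apply/eqP => /(congr1 (fun z => qc * z)); rewrite mulfV ?mulr1 ?qc_neq0//.
  by move/(@complexI R) => h; move: q1; rewrite -h ltxx.
move: (expf_neq0 'C(k, 2) q10) (qn0 'C(k, 2)).
rewrite exprMn exprVn -/qc.
move: (Delta (\row_i _)) (\prod_(i < k) qPoch qc (qc ^+ (k - i))) => dv pq.
move: (\prod_(i < k) qPoch _ _) (\prod_(i < k) _ ^ _) (\det _) => px pz dt.
move: (qPoch qc qc ^+ k) (qc ^- (2 * 'C(k, 3))) ((qc^-1 - 1) ^+ 'C(k, 2)) (qc ^+ 'C(k, 2))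
  ((-1) ^+ 'C(k, 2)) => a b c d s c0 d0 px0 H.
transitivity (pz * dt / (Delta x * px) * (d^-1 * b * s * a)); first by field; rewrite px0 D0 c0 d0.
by rewrite H; field; rewrite px0 D0.
Qed.

Lemma Fnuk_dom_good (x : 'rV[C]_k) : Fnuk_dom x ->
  exists r d, [/\ 1 <= r, 0 < d & good_set q r d x].
Proof.
move=> [xD xP]; have D0 := Delta_neq0 xD.
have H : exists2 d : R, 0 < d & forall (i : 'I_k) (j : nat), d <= cmod (1 - x 0 i * qc ^+ (k + j)).
  have Hi (i : 'I_k) : {d : R | 0 < d & forall j : nat, d <= cmod (1 - x 0 i * qc ^+ (k + j))}.
    have [d d0 Hd] := cid2 (qPoch_bounded_below q0 q1 ((qPoch_neq0P q0 q1 _).1 (xP i))).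
    by exists d => // j; rewrite exprD mulrA.
  exists (\big[Num.min/1]_i s2val (Hi i)).
    apply: (big_ind (fun d : R => 0 < d)) => // [a b a0 b0|i _]; first by rewrite lt_min a0 b0.
    by case: (Hi i).
  move=> i j; apply: le_trans (bigmin_le_cond _ (fun i => s2val (Hi i)) (isT : xpredT i)) _.
  by case: (Hi i).
have [d d0 Hd] := H.
exists (1 + \sum_i cmod (x 0 i)), (Num.min d (cmod (Delta x))); split.
- by rewrite lerDl sumr_ge0// => i _; exact: cmod_ge0.
- by rewrite lt_min d0 cmod_gt0.
split=> [i||i j].
- rewrite (bigD1 i)//= addrCA lerDl addr_ge0// sumr_ge0// => j _; exact: cmod_ge0.
- by rewrite ge_min lexx orbT.
- by rewrite ge_min Hd.
Qed.

(** Nonvanishing of the q-Pochhammer symbol is infinitely many conditions, but for t <= 1 the moving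
    point stays bounded, so factors of index at least J are nonzero; the finitely many others are
    affine in t. *)
Lemma closure_Fnuk_dom (x : 'rV[C]_k) : closure Fnuk_dom x.
Proof.
apply: closure_rline.
have H1 := rline_distinct_nonzero x.
have H2 : \forall t \near (0 : R)^'+, forall i, qPoch qc (rline x t 0 i * qc ^+ k) != 0.
  apply: filter_forall => i.
  pose r := cmod (x 0 i) + i.+1%:R.
  have r0 : 0 <= r by rewrite addr_ge0 ?cmod_ge0.
  have [J HJ] : exists J, r * q ^+ J <= 2^-1.
    have h : 0 < 2^-1 :> R by rewrite invr_gt0 ltr0n.
    have /cvgrPdist_le/(_ _ h)[J _ /(_ J (leqnn J))] := cvg_geo0 q0 q1 r.
    by rewrite /= sub0r normrN => /(le_trans (ler_norm _)); exists J.
  have HF : \forall t \near (0 : R)^'+, forall j : 'I_J, 1 - rline x t 0 i * qc ^+ k * qc ^+ j != 0.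
    apply: filter_forall => j.
    have b0 : - (i.+1%:R * qc ^+ k * qc ^+ j) != 0 :> C.
      by rewrite oppr_eq0 !mulf_neq0 ?pnatr_eq0.
    apply: filterS (affine_neq0 (1 - x 0 i * qc ^+ k * qc ^+ j) b0) => t.
    by apply: contraNneq; rewrite mxE => <-; apply/eqP; ring.
  near=> t; have t0 : 0 < t by [].
  have t1 : t <= 1 by near: t; apply: nbhs_right_le.
  have HFt : forall j : 'I_J, 1 - rline x t 0 i * qc ^+ k * qc ^+ j != 0 by near: t.
  apply/(qPoch_neq0P q0 q1) => j.
  have [jJ|Jj] := ltnP j J; first exact: (HFt (Ordinal jJ)).
  rewrite -cmod_gt0 (lt_le_trans _ (cmod_lerB _ _))// cmod1 subr_gt0.
  apply: (@le_lt_trans _ _ 2^-1); last by rewrite invf_lt1 ?ltr1n ?ltr0n.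
  apply: le_trans HJ; rewrite -mulrA -exprD cmodM cmod_qcX//.
  rewrite ler_pM ?cmod_ge0 ?exprn_ge0 ?(ltW q0)//; last first.
    by apply: qpow_le => //; rewrite (leq_trans Jj)// leq_addl.
  rewrite mxE (le_trans (cmodD _ _))// lerD2l cmodM cmod_real gtr0_norm//.
  rewrite -(rmorph_nat (real_complex R)) cmod_real ger0_norm//.
  by rewrite ler_piMl.
near=> t; split; first by near: t.
by near: t.
Unshelve. all: by end_near. Qed.

End Fnuk.

(** * Compact sets and exponents counted from the bottom *)

Lemma ucv_uniform (R : realType) (T : choiceType) (A : set T) (f : nat -> T -> cplx R) g :
  ucv A f g -> {uniform A, f @ \oo --> g}.
Proof.
move=> [_ cv] P /uniform_nbhs[U [entU sU]].
have [e' e'0 HU] : exists2 e : cplx R, 0 < e & [set xy | ball xy.1 e xy.2] `<=` U.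
  by move: entU; rewrite -entourage_ballE => -[e e0 He]; exists e.
have [e e0 ee] := gt0_cplx e'0.
have e20 : 0 < e / 2 by rewrite divr_gt0.
apply: filterS (cv _ e20) => N HN; apply: sU => x Ax; apply: HU => /=.
rewrite /ball/= cmodE ee ltcR cmodC (le_lt_trans (HN _ Ax))//.
by rewrite ltr_pdivrMr// ltr_pMr// ltr1n.
Qed.

(** Integers at distance less than 1 coincide. *)
Lemma cvg_intr_near (R : realType) (u : nat -> int) (l : int) :
  ((u N)%:~R : R) @[N --> \oo] --> (l%:~R : R) -> \forall N \near \oo, u N = l.
Proof.
move=> /cvgrPdist_lt/(_ _ ltr01); apply: filterS => N /=.
rewrite -rmorphB -intr_norm -[ltRHS]mulr1z ltr_int; lia.
Qed.

Section CompactSets.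
Variable R : realType.
Local Notation C := (cplx R).

Lemma cmod_cvg (x : C) : cmod y @[y --> x] --> cmod x.
Proof.
apply/(@cvgrPdist_le _ _ _ (nbhs x) (nbhs_filter x)) => e e0.
apply: filterS (nbhs_cmod x e0) => y /= h.
rewrite ler_norml; have := cmod_lerB x y; have := cmod_lerB y x.
by move: h; rewrite (cmodC x y); lra.
Qed.

Lemma compact_cmod_le (K : set C) : compact K -> exists r : R, forall x, K x -> cmod x <= r.
Proof.
move=> cK; have : compact ((@cmod R) @` K).
  apply: continuous_compact => //; apply: continuous_subspaceT; exact: cmod_cvg.
move=> /compact_bounded/pinfty_ex_gt0[r r0 Hr]; exists r => x Kx.
by have := Hr (cmod x); rewrite /= ger0_norm ?cmod_ge0//; apply; exists x.
Qed.

Lemma compact_cmod_ge (K : set C) : compact K -> ~ K 0 ->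
  exists2 d : R, 0 < d & forall x, K x -> d <= cmod x.
Proof.
move=> cK K0; have clK := compact_closed (@norm_hausdorff _ _) cK.
have : nbhs 0 (~` K) by apply: open_nbhs_nbhs; split=> //; exact: closed_openC.
move=> /nbhs_ballP[_ /gt0_cplx[d d0 ->] Hd]; exists d => // x Kx.
rewrite leNgt; apply/negP => xd; apply: (Hd x) => //.
by rewrite /ball/= sub0r normrN cmodE ltcR.
Qed.

(** The lower bound on the modulus controls negative powers: this is where compact sets have to
    avoid 0. *)
Lemma cmod_exprz_le (r d : R) (l : int) : 0 < d ->
  exists B : R, forall x : C, d <= cmod x -> cmod x <= r -> cmod (x ^ l) <= B.
Proof.
move=> d0; case: l => n.
  exists (r ^+ n) => x dx xr; rewrite cmodX lerXn2r// nnegrE ?cmod_ge0//.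
  exact: le_trans (cmod_ge0 x) xr.
exists (d ^- n.+1) => x dx xr; rewrite NegzE -exprnN cmodV cmodX.
have c0 := lt_le_trans d0 dx.
by rewrite lef_pV2 ?posrE ?exprn_gt0// lerXn2r// nnegrE ltW.
Qed.

End CompactSets.

Section BottomIndexing.
Variable lam : forall N : nat, N.-tuple int.
Hypothesis lam_sig : forall N, signature (lam N).

Definition bottom (N j : nat) : int := nth 0 (lam N) (N - j.+1).

(* Because of [absz] this is the intended exponent only for [j < N]. *)
Definition bottom_exp (N j : nat) : nat := absz (bottom N j + j%:Z - bottom N 0)%R.

Lemma bottom_mono N i j : (i <= j)%N -> (j < N)%N -> bottom N i <= bottom N j.
Proof.
move=> ij jN; have aN : (N - j.+1 < N)%N by lia.
have bN : (N - i.+1 < N)%N by lia.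
have := @lam_sig N (Ordinal aN) (Ordinal bN); rewrite !(tnth_nth 0) /=.
by apply; lia.
Qed.

Lemma bottom_expE N j : (j < N)%N -> (bottom_exp N j)%:Z = bottom N j + j%:Z - bottom N 0.
Proof.
by move=> jN; rewrite /bottom_exp gez0_abs// subr_ge0 ler_wpDr// bottom_mono.
Qed.

Lemma gapped_bottom_exp N : gapped (bottom_exp N) N.
Proof.
move=> i j ij jN; have := bottom_mono ij jN.
by rewrite -lez_nat PoszD !bottom_expE ?(leq_ltn_trans ij)// -subzn//; lia.
Qed.

Lemma tnth_bottom N (j : 'I_N) :
  tnth (lam N) j + (N - j.+1)%N%:Z = bottom N 0 + (bottom_exp N (N - j.+1))%:Z.
Proof.
have jN := ltn_ord j.
rewrite bottom_expE; last by lia.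
rewrite [bottom N (N - j.+1)]/bottom (_ : (N - (N - j.+1).+1)%N = j); last by lia.
by rewrite (tnth_nth 0); ring.
Qed.

End BottomIndexing.

(** * Convergence of the Schur ratio on compact sets *)

Lemma schur_ratio_factor (R : realType) (q : cplx R) (k N : nat) (lam : N.-tuple int)
    (l0 : int) (e : 'I_N -> nat) : q != 0 -> (k <= N)%N ->
  (forall j : 'I_N, tnth lam j + (N - j.+1)%N%:Z = l0 + (e j)%:Z) ->
  injective (fun j => q ^+ e j) ->
  exists Q : 'rV[cplx R]_k -> cplx R, [/\ polyfun Q,
    forall x : 'rV[cplx R]_k, (forall i, x 0 i != 0) ->
      schur_ratio q lam x = (\prod_(i < k) (x 0 i * q ^+ i) ^ l0) * Q x &
    forall x : 'rV[cplx R]_k,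
      Q x * Delta x * (\prod_(i < k) \prod_(j < N - k) (x 0 i - q ^- (k + j))) =
      Delta (\row_(i < k) q ^- i) *
      (\prod_(i < k) \prod_(j < N - k) (q ^- i - q ^- (k + j))) *
      \det (\matrix_(i < k, j < k) lagP q e (x 0 i * q ^+ j))].
Proof.
move=> q0 kN; have [m E] : exists m, N = (k + m)%N by exists (N - k)%N; rewrite subnKC.
by subst N; rewrite addKn; exact: schur_ratioE.
Qed.

Theorem theorem6p5 (R : realType) (q : R) (k : nat) (nu : nat -> int)
    (lam : forall N : nat, N.-tuple int) (K : 'I_k -> set (cplx R)) :
  0 < q -> q < 1 -> (0 < k)%N ->
  (forall j : nat, nu j <= nu j.+1) ->
  (forall N : nat, signature (lam N)) ->
  (forall j : nat,
     ((nth 0 (lam N) (N - j.+1))%:~R : R) @[N --> \oo] --> ((nu j)%:~R : R)) ->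
  (forall i : 'I_k, compact (K i)) ->
  (forall i : 'I_k, ~ K i 0) ->
  {uniform [set x : 'rV[cplx R]_k | forall i : 'I_k, K i (x 0 i)],
    (fun N : nat => schur_ratio (real_complex R q : cplx R) (lam N)) @ \oo -->
    Fnuk (real_complex R q : cplx R) nu (k := k)}.
Proof.
move=> q0 q1 k0 nu_le lam_sig lam_nu cK K0.
pose qc : cplx R := real_complex R q.
have qc0 : qc != 0 by exact: qc_neq0.
have cvb j : \forall N \near \oo, bottom lam N j = nu j by exact: cvg_intr_near (lam_nu j).
have gE := gapped_bottom_exp lam_sig; have ge := gapped_nu_exp nu_le.
have cE j : \forall N \near \oo, bottom_exp lam N j = nu_exp nu j.
  near=> N; have b0 : bottom lam N 0 = nu 0 by near: N; exact: cvb.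
  have bj : bottom lam N j = nu j by near: N; exact: cvb.
  by rewrite /bottom_exp b0 bj.
have exQ N : exists Q : 'rV[cplx R]_k -> cplx R, polyfun Q /\ ((k <= N)%N ->
    (forall x : 'rV[cplx R]_k, (forall i, x 0 i != 0) ->
      schur_ratio qc (lam N) x = (\prod_(i < k) (x 0 i * qc ^+ i) ^ bottom lam N 0) * Q x) /\
    forall x : 'rV[cplx R]_k,
      Q x * Delta x * (\prod_(i < k) \prod_(j < N - k) (x 0 i - qc ^- (k + j))) =
      Delta (\row_(i < k) qc ^- i) *
      (\prod_(i < k) \prod_(j < N - k) (qc ^- i - qc ^- (k + j))) *
      \det (\matrix_(i < k, j < k)
        lagP qc (fun j : 'I_N => bottom_exp lam N (N - j.+1)%N) (x 0 i * qc ^+ j))).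
  (* For N < k nothing is asserted and 0 is a placeholder, so that choice yields a polynomial for
     every N. *)
  have [kN|Nk] := leqP k N; last by exists (fun=> 0); split=> //; exact: polyfun_cst.
  have [Q [pQ HQ1 HQ2]] := schur_ratio_factor qc0 kN (tnth_bottom lam_sig (N := N))
    (gapped_inj q0 q1 (@gE N)).
  by exists Q.
have [Q HQ] := choice exQ.
have pQ N : polyfun (Q N) by case: (HQ N).
have eqQ : \forall N \near \oo, forall x : 'rV[cplx R]_k,
  Q N x * Delta x * (\prod_(i < k) \prod_(j < N - k) (x 0 i - qc ^- (k + j))) =
  Delta (\row_(i < k) qc ^- i) *
  (\prod_(i < k) \prod_(j < N - k) (qc ^- i - qc ^- (k + j))) *
  \det (\matrix_(i < k, j < k)
    lagP qc (fun j : 'I_N => bottom_exp lam N (N - j.+1)%N) (x 0 i * qc ^+ j)).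
  near=> N; have kN : (k <= N)%N by near: N; exact: nbhs_infty_ge.
  by have [_ /(_ kN)[]] := HQ N.
(* The limit of the Schur ratio in a form that is continuous wherever all coordinates are nonzero;
   agreement with the raw formula on its dense domain then identifies it with [Fnuk]. *)
pose g (x : 'rV[cplx R]_k) : cplx R := (\prod_(i < k) (x 0 i * qc ^+ i) ^ nu 0) * Qlim Q x.
have FnukE (x : 'rV[cplx R]_k) : (forall i, x 0 i != 0) -> Fnuk qc nu x = g x.
  move=> x0; rewrite /Fnuk; apply: (cont_ext_eq (g := g)).
  - move=> y Hy; rewrite Fnuk_formula// /g.
    have [r [d [r1 d0 gy]]] := Fnuk_dom_good q0 q1 Hy.
    by rewrite (Qlim_good q0 q1 ge gE cE eqQ r1 d0 gy).
  - apply: continuousM; last exact: (Qlim_continuous q0 q1 ge gE cE pQ eqQ).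
    apply: continuous_prod => i.
    have nz : x 0 i * qc ^+ i != 0 by rewrite mulf_neq0// expf_neq0.
    apply: (@continuous_exprz R _ (fun y : 'rV[cplx R]_k => y 0 i * qc ^+ i) x (nu 0)).
      exact: nz.
    apply: continuousM; [exact: coord_continuous|exact: cst_continuous].
  - exact: closure_Fnuk_dom.
apply: ucv_uniform; set A := [set x | _].
have A0 x : A x -> forall i, x 0 i != 0.
  by move=> Ax i; apply/eqP => x0; apply: (K0 i); rewrite -x0; exact: Ax.
apply: (@ucv_ext _ _ _ _ g); first by move=> x Ax; rewrite FnukE//; exact: A0.
(* The lowest exponent is eventually [nu 0], so the monomial no longer depends on N and only [Q N]
   has to converge. *)
apply: (@ucv_near _ _ _ (fun N (x : 'rV[cplx R]_k) =>
  (\prod_(i < k) (x 0 i * qc ^+ i) ^ nu 0) * Q N x)).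
  near=> N => x Ax; have kN : (k <= N)%N by near: N; exact: nbhs_infty_ge.
  have b0 : bottom lam N 0 = nu 0 by near: N; exact: cvb.
  have [_ /(_ kN)[H _]] := HQ N.
  by rewrite H ?b0//; exact: A0.
apply: ucvM.
  apply: ucv_cst; apply: ubd_prod => i.
  have [r Hr] := compact_cmod_le (cK i).
  have [d d0 Hd] := compact_cmod_ge (cK i) (K0 i).
  have dq0 : 0 < d * q ^+ i by rewrite mulr_gt0// exprn_gt0.
  have [B HB] := cmod_exprz_le (r * q ^+ i) (nu 0) dq0.
  exists B => x Ax; apply: HB; rewrite cmodM cmod_qcX// ler_pM2r ?exprn_gt0//.
    by apply: Hd; exact: Ax.
  by apply: Hr; exact: Ax.
have [r Hr] := choice (fun i => compact_cmod_le (cK i)).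
(* A common radius for a polydisc containing the product of the compact sets. *)
pose M : R := 1 + \sum_i `|r i|.
have M0 : 0 < M by rewrite ltr_pwDl// sumr_ge0.
apply: (ucv_sub _ (Q_ucv q0 q1 ge gE cE pQ eqQ M0)) => x Ax i.
apply: (le_trans (Hr i _ (Ax i))); apply: (le_trans (ler_norm _)).
by rewrite /M (bigD1 i)//= addrCA lerDl addr_ge0// sumr_ge0.
Unshelve. all: by end_near. Qed.
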